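(* If a puzzle has gentle loops, it is not rigid.
   Context: Puzzles. Work in the triangular lattice in the plane with one family of lattice lines horizontal. A puzzle piece is one of: (i) a unit lattice triangle with all edges labeled $0$; (ii) a unit lattice triangle with all edges labeled $1$; (iii) a unit rhombus (two unit lattice triangles joined along an edge, in any of the three lattice orientations) labeled so that, traversing its boundary clockwise, an edge is labeled $1$ if it immediately follows an obtuse ($120^\circ$) vertex and $0$ if it immediately follows an acute ($60^\circ$) vertex. A puzzle of size $n$ is a decomposition of the upward-pointing lattice triangle of side-length $n$ into lattice polygons, all edges labeled $0$ or $1$, such that each region is a puzzle piece (so neighboring pieces agree on the label of a common edge). A puzzle is rigid if it is the only puzzle of its size with its labels on the boundary of the triangle. Gentle loops. A region edge of a puzzle is an interior edge separating two distinct types of puzzle piece (the types being $0$-triangle, $1$-triangle, rhombus); it necessarily separates a rhombus from a triangle. Region edges are oriented so that a $0$-triangle is on the left, resp. a $1$-triangle is on the right. A gentle path is a finite list of region edges such that the head of each is the tail of the next and the angle of turn is $0^\circ$ or $60^\circ$ (to either side), never $120^\circ$. A gentle loop is a gentle path (with at least two entries) whose first and last edges coincide. *)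

(* Defs.v *)
From HB Require Import structures.
From mathcomp Require Import all_boot all_order all_algebra finmap.

Set Implicit Arguments.
Unset Strict Implicit.
Unset Printing Implicit Defensive.

Import Order.TTheory GRing.Theory Num.Theory.
Local Open Scope ring_scope.

(* [(a, b)] stands for the point a.u + b.v of the plane, where u is the
   horizontal unit vector and v is u turned by 60 degrees counterclockwise. *)
Definition point : Type := (int * int)%type.

(* Linear rotation by 60 degrees counterclockwise: u |-> v, v |-> v - u. *)
Definition rot (d : point) : point := (- d.2, d.1 + d.2).

(* The unit vector at k * 60 degrees from the horizontal; the angle is in 'Z_6,
   so that angles are added modulo 360 degrees. *)
Definition dir (k : 'Z_6) : point := iter k rot (1, 0).

(* A unit lattice edge, oriented: its tail and its direction. *)
Definition dedge : Type := (point * 'Z_6)%type.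

Definition tail (e : dedge) : point := e.1.
Definition tip (e : dedge) : point := e.1 + dir e.2.
Definition opp_edge (e : dedge) : dedge := (tip e, e.2 + 3).

(* [(p, up)] is the unit triangle with vertices p, p + dir k, p + dir (k + 1),
   where k is 0 if it points upward and 1 if it points downward. So p is the
   lower left vertex in the first case and the bottom vertex in the second. *)
Definition cell : Type := (point * bool)%type.

Definition cell_dir (up : bool) : 'Z_6 := if up then 0 else 1.

Definition cell_vertices (c : cell) : seq point :=
  let k := cell_dir c.2 in [:: c.1; c.1 + dir k; c.1 + dir (k + 1)].

(* Puzzle pieces placed in the lattice, as labeled polygons; the label 0 is
   [false] and the label 1 is [true]. [Triangle b c] is the unit triangle c with
   all edges labeled b. [Rhombus p k] is the rhombus with vertices p,
   p + dir k, p + dir k + dir (k + 1), p + dir (k + 1), whose acute vertices are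
   the first and the third ones; each rhombus is obtained exactly once, since
   k < 3 selects one of its two acute vertices as p. *)
Inductive piece : Type :=
  | Triangle of bool & cell
  | Rhombus of point & 'I_3.

Definition piece_encode (q : piece) : bool * cell + point * 'I_3 :=
  match q with Triangle b c => inl (b, c) | Rhombus p k => inr (p, k) end.
Definition piece_decode (x : bool * cell + point * 'I_3) : piece :=
  match x with inl (b, c) => Triangle b c | inr (p, k) => Rhombus p k end.
Lemma piece_encodeK : cancel piece_encode piece_decode.
Proof. by case. Qed.
HB.instance Definition _ := Countable.copy piece (can_type piece_encodeK).

(* The labeled edges of a piece, traversed clockwise: the piece lies to the
   right of each of them. In a rhombus, the edges that leave an acute vertex are
   labeled 0 and those that leave an obtuse vertex are labeled 1. *)
Definition boundary (q : piece) : seq (dedge * bool) :=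
  match q with
  | Triangle b (p, up) =>
      let k := cell_dir up in
      [:: ((p, k + 1), b); ((p + dir (k + 1), k - 1), b); ((p + dir k, k + 3), b)]
  | Rhombus p i =>
      let k : 'Z_6 := inZp i in
      [:: ((p, k + 1), false);
          ((p + dir (k + 1), k), true);
          ((p + dir k + dir (k + 1), k + 4), false);
          ((p + dir k, k + 3), true)]
  end.

Definition vertices (q : piece) : seq point := [seq tail x.1 | x <- boundary q].

(* As pieces are unit triangles and unit rhombi, a unit triangle is contained in
   a piece as soon as its vertices are vertices of the piece. *)
Definition covers (q : piece) (c : cell) : Prop :=
  {subset cell_vertices c <= vertices q}.

Definition in_triangle (n : nat) (p : point) : bool :=
  [&& 0 <= p.1, 0 <= p.2 & p.1 + p.2 <= n%:Z].

Definition decomposes (n : nat) (P : {fset piece}) : Prop :=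
  (forall q, q \in P -> all (in_triangle n) (vertices q)) /\
  (forall c, all (in_triangle n) (cell_vertices c) ->
     exists! q, q \in P /\ covers q c).

Definition labels_agree (P : {fset piece}) : Prop :=
  forall q r e a b, q \in P -> r \in P ->
    (e, a) \in boundary q -> (opp_edge e, b) \in boundary r -> a = b.

Definition is_puzzle (n : nat) (P : {fset piece}) : Prop :=
  decomposes n P /\ labels_agree P.

(* The edges of the boundary of the triangle of side n, clockwise from the lower
   left corner. *)
Definition outer_edges (n : nat) : seq dedge :=
  [seq ((0, i%:Z), 1) | i <- iota 0 n] ++
  [seq ((i%:Z, n%:Z - i%:Z), 5) | i <- iota 0 n] ++
  [seq ((n%:Z - i%:Z, 0), 3) | i <- iota 0 n].

(* The edge e has label b in the piece of P to its right. *)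
Definition edge_label (P : {fset piece}) (e : dedge) (b : bool) : Prop :=
  exists2 q, q \in P & (e, b) \in boundary q.

Definition same_outer_labels (n : nat) (P Q : {fset piece}) : Prop :=
  forall e b, e \in outer_edges n -> edge_label P e b <-> edge_label Q e b.

Definition rigid (n : nat) (P : {fset piece}) : Prop :=
  forall Q, is_puzzle n Q -> same_outer_labels n P Q -> Q = P.

(* [Some b] for triangles labeled b and [None] for rhombi. *)
Definition kind (q : piece) : option bool :=
  if q is Triangle b _ then Some b else None.

Definition left_piece (P : {fset piece}) (e : dedge) (q : piece) : Prop :=
  q \in P /\ opp_edge e \in [seq x.1 | x <- boundary q].
Definition right_piece (P : {fset piece}) (e : dedge) (q : piece) : Prop :=
  q \in P /\ e \in [seq x.1 | x <- boundary q].

(* The edge e is a region edge and carries the orientation of region edges: a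
   0-triangle is on its left or a 1-triangle is on its right. *)
Definition region_edge (P : {fset piece}) (e : dedge) : Prop :=
  exists q r, [/\ left_piece P e q, right_piece P e r, kind q <> kind r
                & kind q = Some false \/ kind r = Some true].

Definition gentle_step (e f : dedge) : bool :=
  (tip e == tail f) && (f.2 - e.2 \in [:: 0; 1; -1]).

Definition gentle_path (P : {fset piece}) (s : seq dedge) : Prop :=
  (forall e, e \in s -> region_edge P e) /\ sorted gentle_step s.

Definition gentle_loop (P : {fset piece}) (s : seq dedge) : Prop :=
  [/\ gentle_path P s, (1 < size s)%N & forall e, head e s = last e s].

(* Main.v *)
Require Import Defs.
From mathcomp Require Import all_boot all_order all_algebra finmap zify.

Set Implicit Arguments.
Unset Strict Implicit.
Unset Printing Implicit Defensive.

Import Order.TTheory GRing.Theory Num.Theory.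
Local Open Scope ring_scope.

(** A puzzle is the same thing as a labelling of the edges of the triangle of
    side n by 0, 1 and a third label for the short diagonals of rhombi
    ([Some false], [Some true] and [None]): counterclockwise, the labels of each
    face must be 000, 111 or a rotation of (0, 1, diagonal) ([faces]).

    Assign to an edge of direction d the displacement d if it is labelled 0, the
    null vector if it is labelled 1, and d turned by -60 degrees if it is a
    diagonal ([displacement]). The admissible faces are exactly those whose
    displacements sum to zero, except for the spurious face with three diagonals
    ([faces_displacement], [displacement_faces]). So a puzzle is a vector-valued
    height function on the lattice points whose increments along the edges are
    admissible, and it can be changed by moving the heights of some points.

    Given a gentle loop, move the height of each vertex of the loop by a unit
    vector, obtained from the edge that enters the vertex by a left turn of 120
    degrees if this edge is labelled 0, and of 60 degrees if it is labelled 1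
    ([push]). There are only eight ways, up to rotation, in which a gentle path
    can pass through a vertex. Inspecting them shows that the increments remain
    admissible along the edges of the loop ([push_along]) and along all edges
    that join a vertex of the loop to a vertex off the loop ([push_side]), and
    that no spurious face arises ([push_corner]). All vertices of the loop are
    interior points, hence the labels on the boundary do not change.

    This argument needs that the loop passes at most once through each vertex,
    and that no two vertices at distance 1, other than consecutive ones, are on
    the loop: such a chord would always be spoiled, as both of its ends are
    moved. Both properties hold for a loop of minimal length. If the loop meets a
    vertex twice, then one of the two ways of reconnecting the strands there is
    gentle and gives a shorter loop ([tip_neq]). If there is a chord from the
    vertex i to the vertex i + m of the loop, consider the face on the side of
    the arc from i to i + m ([no_labelled_chord]). If it is a half of a rhombus,
    the opposite side of the rhombus is a chord from i + 1 to i + m - 1. If it is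
    a triangle one of whose edges is on the arc, its third edge is a chord with a
    shorter arc. In the remaining cases, the chord is a region edge that provides
    a shortcut of the loop, or the loop makes a turn of 120 degrees. Descent on m
    excludes chords ([no_chord]). *)

(** * Directions, labels and displacements *)

Definition Z6 : seq 'Z_6 := [:: 0; 1; 2; 3; 4; 5].

Lemma Z6_ind (Q : 'Z_6 -> Prop) :
  Q 0 -> Q 1 -> Q 2 -> Q 3 -> Q 4 -> Q 5 -> forall k, Q k.
Proof.
move=> q0 q1 q2 q3 q4 q5 [[|[|[|[|[|[|//]]]]]] lt_k].
- by rewrite (_ : Ordinal lt_k = 0) //; apply: val_inj.
- by rewrite (_ : Ordinal lt_k = 1) //; apply: val_inj.
- by rewrite (_ : Ordinal lt_k = 2) //; apply: val_inj.
- by rewrite (_ : Ordinal lt_k = 3) //; apply: val_inj.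
- by rewrite (_ : Ordinal lt_k = 4) //; apply: val_inj.
- by rewrite (_ : Ordinal lt_k = 5) //; apply: val_inj.
Qed.

Lemma all_Z6 (p : pred 'Z_6) : all p Z6 -> forall k, p k.
Proof. by rewrite /= => /and5P[? ? ? ? /and3P[? ? _]]; elim/Z6_ind. Qed.

Lemma dir_opp k : dir (k + 3) = - dir k.
Proof. by elim/Z6_ind: k; apply/eqP; vm_compute. Qed.

Lemma dir_neq0 k : dir k != 0.
Proof. by elim/Z6_ind: k; vm_compute. Qed.

Lemma dir_inj : injective dir.
Proof.
move=> k l /eqP e; apply/eqP; move: k l e.
have: all (fun k => all (fun l => (dir k == dir l) ==> (k == l)) Z6) Z6.
  by vm_compute.
by move=> /all_Z6 H k l /(implyP (all_Z6 (H k) l)).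
Qed.

Notation label := (option bool).
Definition displacement (l : label) (k : 'Z_6) : point :=
  match l with Some false => dir k | Some true => 0 | None => dir (k - 1) end.

(** The inverse of [displacement] in a given direction. A vector that is no
    displacement is read as None in both directions of the edge, so that
    [label_at_opp] holds without a condition. *)
Definition label_at (k : 'Z_6) (x : point) : label :=
  if x == 0 then Some true else if x == dir k then Some false else None.

Lemma displacementK l k : label_at k (displacement l k) = l.
Proof. by case: l => [[]|]; elim/Z6_ind: k; vm_compute. Qed.

Lemma displacement_opp l k : displacement l (k + 3) = - displacement l k.
Proof.
case: l => [[]|] /=; rewrite ?oppr0 ?dir_opp //.
by rewrite addrAC dir_opp.
Qed.

Lemma label_at_opp k x : label_at (k + 3) (- x) = label_at k x.
Proof. by rewrite /label_at oppr_eq0 dir_opp eqr_opp. Qed.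

(** Labels of the edges of a face, listed counterclockwise. At the corner p
    between the rays k and k + 1 these are the labels of the ray k, of the
    opposite edge and of the ray k + 1; the direction of the opposite edge is k
    + 2. *)
Definition faces : seq (label * label * label) :=
  [:: (Some false, Some false, Some false); (Some true, Some true, Some true);
      (Some false, Some true, None); (Some true, None, Some false);
      (None, Some false, Some true)].

Lemma faces_displacement x y z k : (x, y, z) \in faces ->
  displacement x k + displacement y (k + 2) = displacement z (k + 1).
Proof.
move: x y z; elim/Z6_ind: k => -[[]|] [[]|] [[]|] //=;
  by move=> _; apply/eqP; vm_compute.
Qed.

(** Three unit vectors sum to zero only if they make angles of 120 degrees; a
    sum of two unit vectors and a null vector vanishes only if the two are
    opposite. *)
Lemma displacement_faces x y z k :
  displacement x k + displacement y (k + 2) = displacement z (k + 1) ->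
  (x, y, z) \in faces \/ (x, y, z) = (None, None, None).
Proof.
move=> /eqP; elim/Z6_ind: k; move: x y z => -[[]|] [[]|] [[]|];
  by [left | right | move=> H; exfalso; move: H; vm_compute].
Qed.

(** * Stars of vertices *)

(** The star of an interior vertex is the sequence of the labels of its six
    rays, in counterclockwise order from the direction 0. *)
Definition at_ray (s : seq label) (k : 'Z_6) : label := nth None s k.

(** The three labels around a region edge that leaves the vertex:
    counterclockwise, either the edge has an acute angle of a rhombus and then a
    0-triangle, or it has a 1-triangle and then an acute angle. *)
Definition out_ray s k : bool :=
  (at_ray s (k - 1), at_ray s k, at_ray s (k + 1)) \in
    [:: (Some true, Some false, Some false); (Some true, Some true, Some false)].
(** The same region edges, seen from their tips: there the angle of the rhombus
    is obtuse, so that its short diagonal is the ray next to the edge. *)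
Definition in_ray s k : bool :=
  (at_ray s (k - 1), at_ray s k, at_ray s (k + 1)) \in
    [:: (Some false, Some false, None); (None, Some true, Some true)].
(** An edge that arrives along the ray a has direction a + 3. *)
Definition gentle_turn (a b : 'Z_6) : bool := b - a \in [:: 2; 3; 4].

Definition passage s a b := [&& in_ray s a, out_ray s b & gentle_turn a b].

(** The direction in which a loop vertex is moved, from the ray a on which the
    loop arrives: the direction a + 3 of the loop, turned by +60 degrees for the
    label 1 and by +120 degrees for the label 0. *)
Definition push (s : seq label) (a : 'Z_6) : 'Z_6 :=
  if at_ray s a == Some true then a - 2 else a - 1.

(** The reflection in a line exchanges the roles of the labels 0 and 1. With
    this sign, the statements on chords labelled 0 and on chords labelled 1
    become one statement. *)
Definition sense (c : bool) : 'Z_6 := if c then -1 else 1.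

(** The finite verifications below are computations on residues modulo 6 that
    are represented by natural numbers. *)
Definition rot6 (k j : nat) : nat := (k + j) %% 6.
Definition in_rayN s k : bool :=
  (nth None s (rot6 k 5), nth None s k, nth None s (rot6 k 1)) \in
    [:: (Some false, Some false, None); (None, Some true, Some true)].
Definition out_rayN s k : bool :=
  (nth None s (rot6 k 5), nth None s k, nth None s (rot6 k 1)) \in
    [:: (Some true, Some false, Some false); (Some true, Some true, Some false)].
Definition gentle_turnN (a b : nat) : bool :=
  rot6 b ((6 - a) %% 6) \in [:: 2; 3; 4]%N.
Definition pushN (s : seq label) (a : nat) : nat :=
  rot6 a (if nth None s a == Some true then 4 else 5).
Definition senseN (c : bool) : nat := if c then 5 else 1.
Definition antisenseN (c : bool) : nat := if c then 1 else 5.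

(** The rays k and k + 1 are two edges of a face. *)
Definition star_ok (s : seq label) : bool :=
  all (fun k => (nth None s k, nth None s (rot6 k 1)) \in
                  [seq (f.1.1, f.2) | f <- faces]) (iota 0 6).

Lemma pushNE s (a : 'Z_6) : push s a = pushN s a :> nat.
Proof. by rewrite /push /pushN -[at_ray s a]/(nth None s a); case: ifP. Qed.

Fixpoint words (n : nat) : seq (seq label) :=
  if n is m.+1 then
    flatten [seq [seq x :: s | x <- [:: Some false; Some true; None]] | s <- words m]
  else [:: [::]].

Lemma mem_words s : s \in words (size s).
Proof.
elim: s => //= x s IH; apply/flattenP.
exists [seq y :: s | y <- [:: Some false; Some true; None]]; first exact: map_f.
by case: x => [[]|]; rewrite !inE eqxx ?orbT.
Qed.

Definition stars : seq (seq label) := Eval vm_compute in filter star_ok (words 6).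

Lemma mem_stars s : size s = 6%N -> star_ok s -> s \in stars.
Proof.
move=> s6 ok_s; rewrite (_ : stars = filter star_ok (words 6)); last by vm_compute.
by rewrite mem_filter ok_s -s6 mem_words.
Qed.

Lemma mem_iota6 (k : 'Z_6) : (k : nat) \in iota 0 6.
Proof. by rewrite mem_iota /=; exact: ltn_ord. Qed.

Lemma passage_check (F : seq label -> nat -> nat -> bool) :
  all (fun s => all (fun a => all (F s a)
     (filter (fun b => out_rayN s b && gentle_turnN a b) (iota 0 6)))
     (filter (in_rayN s) (iota 0 6))) stars ->
  forall s (a b : 'Z_6), size s = 6%N -> star_ok s -> passage s a b -> F s a b.
Proof.
move=> /allP chk s a b s6 ok_s /and3P[in_a out_b ab].
have /chk/allP H := mem_stars s6 ok_s.
have {}/H/allP H : (a : nat) \in filter (in_rayN s) (iota 0 6).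
  by rewrite mem_filter mem_iota6 andbT.
apply: (H _ (_ : (b : nat) \in _)); rewrite mem_filter mem_iota6 andbT.
by apply/andP.
Qed.

Lemma side_ray_check (F : seq label -> nat -> nat -> nat -> bool) :
  all (fun s => all (fun a => all (fun b =>
    all (F s a b) (filter (fun t => (t != a) && (t != b)) (iota 0 6)))
     (filter (fun b => out_rayN s b && gentle_turnN a b) (iota 0 6)))
     (filter (in_rayN s) (iota 0 6))) stars ->
  forall s (a b t : 'Z_6), size s = 6%N -> star_ok s -> passage s a b ->
  t != a -> t != b -> F s a b t.
Proof.
move=> chk s a b t s6 ok_s pass ta tb.
have /allP H : all (F s a b)
    (filter (fun t : nat => (t != a :> nat) && (t != b :> nat)) (iota 0 6)).
  exact: (@passage_check (fun s a b =>
    all (F s a b) (filter (fun t => (t != a) && (t != b)) (iota 0 6))) chk).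
apply: (H _ (_ : (t : nat) \in _)); rewrite mem_filter mem_iota6 andbT.
by apply/andP.
Qed.

Section Local.
Variables (s : seq label) (a b : 'Z_6).
Hypotheses (s6 : size s = 6%N) (ok_s : star_ok s) (pass : passage s a b).

(** Where two passages cross or touch, each of them can be continued by the
    other one in at least one of the two ways. *)
Lemma swap_passages a' b' : passage s a' b' -> gentle_turn a b' || gentle_turn a' b.
Proof.
move=> /and3P[in_a' out_b' ab'].
have /allP H := passage_check (F := fun s a b => all (fun a' => all (fun b' => 
     gentle_turnN a b' || gentle_turnN a' b)
     (filter (fun b => out_rayN s b && gentle_turnN a' b) (iota 0 6)))
     (filter (in_rayN s) (iota 0 6))) ltac:(by vm_compute) s6 ok_s pass.
have {}/H/allP H : (a' : nat) \in filter (in_rayN s) (iota 0 6).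
  by rewrite mem_filter mem_iota6 andbT.
apply: (H _ (_ : (b' : nat) \in _)); rewrite mem_filter mem_iota6 andbT.
by apply/andP.
Qed.

(** This keeps the outgoing edge admissible: its tip is pushed in direction
    b + 2 or b + 1 according to its label, which leaves the displacement
    [dir b] or 0. *)
Lemma push_along : push s a \in [:: b + 1; b + 2].
Proof.
have := passage_check (F := fun s a b => pushN s a \in [:: rot6 b 1; rot6 b 2])
  ltac:(by vm_compute) s6 ok_s pass.
by rewrite -pushNE.
Qed.

Variable t : 'Z_6.
Hypotheses (ta : t != a) (tb : t != b).
Let check F chk := @side_ray_check F chk s a b t s6 ok_s pass ta tb.

(** For each label of a ray, these are the two directions d for which the
    displacement minus d is another admissible displacement along the ray. *)
Lemma push_side : push s a \in
  match at_ray s t with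
  | Some false => [:: t; t + 1]
  | Some true => [:: t + 2; t + 3]
  | None => [:: t - 2; t - 1]
  end.
Proof.
have := check (F := fun s a b t => pushN s a \in
    match nth None s t with
    | Some false => [:: t; rot6 t 1]
    | Some true => [:: rot6 t 2; rot6 t 3]
    | None => [:: rot6 t 4; rot6 t 5]
    end) ltac:(by vm_compute).
by rewrite -pushNE /at_ray; case: (nth _ _ _) => [[]|].
Qed.

(** The push that would turn both edges of an acute angle into diagonals does
    not occur unless the loop runs along one of these edges. *)
Lemma push_corner : t + 1 != a -> t + 1 != b -> at_ray s t = Some true ->
  at_ray s (t + 1) = Some false -> push s a != t + 2.
Proof.
move=> ta' tb' /eqP r1 /eqP r2; rewrite -val_eqE /= pushNE.
move: r2; apply/implyP; move: r1; apply/implyP.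
move: tb'; apply/implyP; move: ta'; apply/implyP.
exact: (check (F := fun s a b t => [==> rot6 t 1 != a, rot6 t 1 != b,
    nth None s t == Some true, nth None s (rot6 t 1) == Some false =>
    pushN s a != rot6 t 2]) ltac:(by vm_compute)).
Qed.

Lemma chord_diagonal : at_ray s t = None ->
  [/\ at_ray s (t + 1) = Some true, at_ray s (t - 1) = Some false
    & (a == t - 1) || (a == t + 1)].
Proof.
move=> r1; have : [&& nth None s (rot6 t 1) == Some true,
    nth None s (rot6 t 5) == Some false
    & (a == rot6 t 5 :> nat) || (a == rot6 t 1 :> nat)].
  move/eqP: r1; apply/implyP.
  exact: (check (F := fun s a b t => (nth None s t == None) ==>
    [&& nth None s (rot6 t 1) == Some true, nth None s (rot6 t 5) == Some false
      & (a == rot6 t 5) || (a == rot6 t 1)]) ltac:(by vm_compute)).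
by case/and3P=> /eqP ? /eqP ? ?; split.
Qed.

Variable c : bool.

(** An acute angle next to the chord: the loop leaves along its other side. *)
Lemma chord_rhombus_out : at_ray s t = Some c -> at_ray s (t - sense c) = Some (~~ c) ->
  b = t - sense c.
Proof.
move=> /eqP r1 /eqP r2; apply/eqP; move: r2; apply/implyP; move: r1; apply/implyP.
have := check (F := fun s a b t => all (fun c => [==> nth None s t == Some c,
   nth None s (rot6 t (antisenseN c)) == Some (~~ c) =>
   b == rot6 t (antisenseN c)]) [:: true; false])
  ltac:(by vm_compute).
by case: c => /and3P[].
Qed.

(** An obtuse angle next to the chord, of which t + sense c is the bisecting
    diagonal: the loop arrives along its other side. *)
Lemma chord_rhombus_in : at_ray s t = Some c -> at_ray s (t + sense c) = None ->
  a = t + sense c + sense c.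
Proof.
move=> /eqP r1 /eqP r2; apply/eqP; move: r2; apply/implyP; move: r1; apply/implyP.
have := check (F := fun s a b t => all (fun c => [==> nth None s t == Some c,
   nth None s (rot6 t (senseN c)) == None =>
   a == rot6 (rot6 t (senseN c)) (senseN c)]) [:: true; false])
  ltac:(by vm_compute).
by case: c => /and3P[].
Qed.

(** If the loop does not leave along the triangle next to the chord, then either
    it arrives along the face on the other side of the chord, or the chord is a
    region edge pointing to the vertex, and the loop could have arrived along
    it. *)
Lemma chord_triangle_out :
  at_ray s t = Some c -> at_ray s (t - sense c) = Some c -> b != t - sense c ->
  (a == t + sense c) || in_ray s t && gentle_turn t b.
Proof.
move=> /eqP r1 /eqP r2; apply/implyP; move: r2; apply/implyP;
move: r1; apply/implyP.
have := check (F := fun s a b t => all (fun c => [==> nth None s t == Some c,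
   nth None s (rot6 t (antisenseN c)) == Some c, b != rot6 t (antisenseN c) =>
   (a == rot6 t (senseN c)) || in_rayN s t && gentle_turnN t b]) [:: true; false])
  ltac:(by vm_compute).
by case: c => /and3P[].
Qed.

(** If the loop does not arrive along the triangle next to the chord, then it
    leaves along the face on the other side, and it could have left along the
    chord if this is a region edge. *)
Lemma chord_triangle_in :
  at_ray s t = Some c -> at_ray s (t + sense c) = Some c -> a != t + sense c ->
  (b == t - sense c) && (out_ray s t ==> gentle_turn a t).
Proof.
move=> /eqP r1 /eqP r2; apply/implyP; move: r2; apply/implyP;
move: r1; apply/implyP.
have := check (F := fun s a b t => all (fun c => [==> nth None s t == Some c,
   nth None s (rot6 t (senseN c)) == Some c, a != rot6 t (senseN c) =>
   (b == rot6 t (antisenseN c)) && (out_rayN s t ==> gentle_turnN a t)])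
   [:: true; false])
  ltac:(by vm_compute).
by case: c => /and3P[].
Qed.
End Local.

(** * Labellings of the triangle *)

Ltac by_rays k :=
  apply/eqP; generalize k; apply: Z6_ind; vm_compute; reflexivity.

Definition around (lab : dedge -> label) (v : point) : seq label :=
  [seq lab (v, k) | k <- Z6].

Lemma at_around lab v k : at_ray (around lab v) k = lab (v, k).
Proof. by elim/Z6_ind: k. Qed.

(** The form that region edges take in a labelling; that they are interior is
    said by [flanked]. *)
Definition region (lab : dedge -> label) (e : dedge) : bool :=
  out_ray (around lab (tail e)) e.2.

Definition flanked (n : nat) (e : dedge) : bool :=
  all (in_triangle n)
    [:: tail e; tip e; tail e + dir (e.2 - 1); tail e + dir (e.2 + 1)].

Definition interior (n : nat) (v : point) : Prop :=
  in_triangle n v /\ forall k, in_triangle n (v + dir k).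

Record labelling (n : nat) (lab : dedge -> label) : Prop := {
  lab_opp : forall e, lab (opp_edge e) = lab e;
  lab_face : forall p k, in_triangle n p -> in_triangle n (p + dir k) ->
    in_triangle n (p + dir (k + 1)) ->
    (lab (p, k), lab (p + dir k, k + 2), lab (p, k + 1)) \in faces;
  lab_outer : forall e, e \in outer_edges n -> lab e != None
}.

(** Each of the three sides of the triangle bounds a half-plane that two
    consecutive directions leave, so that k - 1 or k + 1 leaves it as soon as k
    does. *)
Lemma in_triangle_between n v k : in_triangle n v ->
  in_triangle n (v + dir (k - 1)) -> in_triangle n (v + dir (k + 1)) ->
  in_triangle n (v + dir k).
Proof.
case: v => x y; rewrite /in_triangle; elim/Z6_ind: k => /=; lia.
Qed.

Section Labelling.
Variables (n : nat) (lab : dedge -> label).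
Hypothesis labP : labelling n lab.

Lemma lab_rev v k : lab (v + dir k, k + 3) = lab (v, k).
Proof. exact: (lab_opp labP (v, k)). Qed.

Lemma interior_face v k : interior n v ->
  (lab (v, k), lab (v + dir k, k + 2), lab (v, k + 1)) \in faces.
Proof. by case=> v_in nv_in; apply: (lab_face labP). Qed.

Lemma size_around v : size (around lab v) = 6%N. Proof. by []. Qed.

Lemma interior_star v : interior n v -> star_ok (around lab v).
Proof.
move=> v_in; apply/allP=> k; rewrite mem_iota => lt_k.
have := interior_face (Ordinal lt_k : 'Z_6) v_in.
move=> /(map_f (fun f : label * label * label => (f.1.1, f.2))).
by rewrite /= -!at_around.
Qed.

Lemma region_tip e : flanked n e ->
  region lab e = in_ray (around lab (tip e)) (e.2 + 3).
Proof.
case: e => p k /and5P[p_in v_in l_in r_in _]; rewrite /= in p_in v_in l_in r_in.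
rewrite /region /out_ray /in_ray !at_around /= -[tip _]/(p + dir k).
have f1 := lab_face labP p_in v_in r_in.
have := lab_face labP p_in l_in; rewrite subrK => /(_ v_in) f2.
rewrite lab_rev.
have -> : k + 3 - 1 = k + 2 by by_rays k.
have <- : lab (p + dir (k - 1), k - 1 + 2) = lab (p + dir k, k + 3 + 1).
  rewrite -[LHS]lab_rev; congr (lab (_, _)); last by by_rays k.
  by rewrite -addrA; congr (_ + _); by_rays k.
move: f1 f2; move: (lab _) (lab _) (lab _) (lab _) (lab _).
by move=> [[]|] [[]|] [[]|] [[]|] [[]|].
Qed.

Lemma gentle_stepE e f : gentle_step e f =
  (tip e == tail f) && gentle_turn (e.2 + 3) f.2.
Proof.
rewrite /gentle_step /gentle_turn; congr (_ && _).
have -> : f.2 - (e.2 + 3) = f.2 - e.2 - 3 by rewrite opprD addrA.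
by elim/Z6_ind: (f.2 - e.2).
Qed.

(** As the turn is gentle, the rays a and b and their neighbours are at least
    five of the six rays. *)
Lemma all_rays_from_passage (T : pred 'Z_6) a b : gentle_turn a b ->
  (forall k, T (k - 1) -> T (k + 1) -> T k) ->
  T (a - 1) -> T a -> T (a + 1) -> T (b - 1) -> T b -> T (b + 1) -> forall k, T k.
Proof.
move=> ab conv; rewrite -[b](subrK a); move: ab; rewrite /gentle_turn.
move: (b - a) => c c234 t5 t0 t1 tc5 tc tc1 k.
rewrite -[k](subrK a); move: (k - a) => {}k.
have t2 : T (2 + a).
  move: c234 tc5 tc tc1; rewrite !inE => /or3P[] /eqP -> // h1 h2 h3.
    by rewrite (_ : 2 + a = 3 + a - 1) //; by_rays a.
  apply: conv.
    by rewrite (_ : 2 + a - 1 = a + 1) //; by_rays a.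
  by rewrite (_ : 2 + a + 1 = 4 + a - 1) //; by_rays a.
have t3 : T (3 + a).
  move: c234 tc5 tc tc1; rewrite !inE => /or3P[] /eqP -> // h1 h2 h3.
    by rewrite (_ : 3 + a = 2 + a + 1) //; by_rays a.
  by rewrite (_ : 3 + a = 4 + a - 1) //; by_rays a.
have t4 : T (4 + a).
  apply: conv.
    by rewrite (_ : 4 + a - 1 = 3 + a) //; by_rays a.
  by rewrite (_ : 4 + a + 1 = a - 1) //; by_rays a.
elim/Z6_ind: k => //.
- by rewrite add0r.
- by rewrite addrC.
- by rewrite (_ : 5 + a = a - 1) //; by_rays a.
Qed.

End Labelling.

Lemma two_hops (p : point) k1 k2 k3 k4 : dir k1 + dir k2 = dir k3 + dir k4 ->
  p + dir k1 + dir k2 = p + dir k3 + dir k4.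
Proof. by rewrite -!addrA => ->. Qed.

Lemma one_hop (p : point) k1 k2 k3 : dir k1 + dir k2 = dir k3 ->
  p + dir k1 + dir k2 = p + dir k3.
Proof. by rewrite -addrA => ->. Qed.

Section Chords.
Variables (n : nat) (lab : dedge -> label).
Hypothesis labP : labelling n lab.

(** The alternative for the face on one side of a labelled edge: it is half of a
    rhombus, or a triangle. *)
Lemma chord_face v t c : interior n v -> lab (v, t) = Some c ->
  if lab (v, t - sense c) == Some (~~ c) then lab (v + dir t, t + 3 + sense c) = None
  else [/\ lab (v, t - sense c) = Some c, lab (v + dir t, t + 3 + sense c) = Some c
         & lab (v + dir (t - sense c), t + sense c) = Some c].
Proof.
move=> v_in; case: c => lab_t /=.
  have := interior_face labP t v_in.
  rewrite opprK (_ : t + 3 - 1 = t + 2); last by by_rays t.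
  rewrite -[lab (_, t - 1)](lab_rev labP) -addrA.
  rewrite (_ : dir (t + 1) + dir (t - 1) = dir t); last by by_rays t.
  rewrite (_ : t - 1 + 3 = t + 2); last by by_rays t.
  rewrite lab_t; move: (lab (v, t + 1)) => x; move: (lab _) => y.
  by case: x y => [[]|] [[]|].
have := interior_face labP (t - 1) v_in.
rewrite (_ : t - 1 + 2 = t + 1) ?subrK; last by by_rays t.
rewrite -[lab (v + dir (t - 1), t + 1)](lab_rev labP) -addrA.
rewrite (_ : dir (t - 1) + dir (t + 1) = dir t); last by by_rays t.
rewrite (_ : t + 1 + 3 = t + 3 + 1); last by by_rays t.
rewrite lab_t; move: (lab (v, t - 1)) => x; move: (lab _) => y.
by case: x y => [[]|] [[]|].
Qed.

(** Opposite sides of a rhombus have the same label. *)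
Lemma chord_far_edge v t c : interior n (v + dir t) ->
  lab (v + dir t, t + 3 + sense c) = None -> lab (v + dir (t - sense c), t) = Some c.
Proof.
move=> w_in; case: c => /= lab_d.
  have := interior_face labP (t + 1) w_in.
  rewrite (_ : t + 1 + 1 = t + 3 - 1) ?lab_d; last by by_rays t.
  rewrite -[lab (_, t + 1 + 2)](lab_rev labP).
  rewrite (_ : t + 1 + 2 + 3 = t); last by by_rays t.
  rewrite (_ : t + 1 + 2 = t + 3) ?dir_opp; last by by_rays t.
  rewrite -[v + dir t + dir (t + 1)]addrA [dir t + _]addrC addrA addrK opprK.
  by move: (lab _) => x; move: (lab _) => y; case: x y => [[]|] [[]|].
have := interior_face labP (t + 3 + 1) w_in.
rewrite lab_d -addrA.
rewrite (_ : dir t + dir (t + 3 + 1) = dir (t - 1)); last by by_rays t.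
rewrite (_ : t + 3 + 1 + 2 = t); last by by_rays t.
by move: (lab _) => x; move: (lab _) => y; case: x y => [[]|] [[]|].
Qed.

Lemma two_steps (b b' t : 'Z_6) : b' - b \in [:: 0; 1; -1] ->
  dir b + dir b' != dir t.
Proof.
rewrite -[b'](subrK b); move: (b' - b) => d; rewrite addrK.
move: d b t; apply: Z6_ind => //; apply: Z6_ind; apply: Z6_ind => _; by vm_compute.
Qed.
End Chords.
(** * Gentle loops of minimal length *)

(** Gentle loops as periodic sequences of edges, which makes all cyclic
    rotations of a loop available by a change of index. *)
Record loop (n : nat) (lab : dedge -> label) (L : nat) (g : nat -> dedge) : Prop := {
    loop_gt0 : (0 < L)%N;
    loop_period : forall i, g (i + L)%N = g i;
    loop_region : forall i, region lab (g i);
    loop_flanked : forall i, flanked n (g i);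
    loop_step : forall i, gentle_step (g i) (g i.+1)
  }.

Lemma loop_of_path n lab M f : (0 < M)%N ->
  (forall t, (t < M)%N -> region lab (f t)) ->
  (forall t, (t < M)%N -> flanked n (f t)) ->
  (forall t, (t.+1 < M)%N -> gentle_step (f t) (f t.+1)) ->
  gentle_step (f M.-1) (f 0%N) -> loop n lab M (fun t => f (t %% M)%N).
Proof.
move=> M_gt0 reg fl step close; split=> // i.
- by rewrite modnDr.
- by apply: reg; rewrite ltn_mod.
- by apply: fl; rewrite ltn_mod.
have lt_i : (i %% M < M)%N by rewrite ltn_mod.
have [lt_i1|] := ltnP (i %% M).+1 M.
  have -> : (i.+1 %% M = (i %% M).+1)%N.
    by rewrite -addn1 -modnDml addn1 modn_small.
  exact: step.
move=> ge_i1; have e_i : (i %% M = M.-1)%N by lia.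
have -> : (i.+1 %% M = 0)%N.
  by rewrite -addn1 -modnDml addn1 e_i prednK // modnn.
by rewrite e_i.
Qed.

Section Minimal.
Variables (n : nat) (lab : dedge -> label) (L : nat) (g : nat -> dedge).
Hypotheses (labP : labelling n lab) (gP : loop n lab L g).
Hypothesis minL : forall L' g', loop n lab L' g' -> (L <= L')%N.

Let v i := tip (g i).
Let a i : 'Z_6 := (g i).2 + 3.
Let b i : 'Z_6 := (g i.+1).2.
Let s i := around lab (v i).

Lemma tail_next i : tail (g i.+1) = v i.
Proof. by have /andP[/eqP] := loop_step gP i. Qed.

Lemma loop_turn i : gentle_turn (a i) (b i).
Proof. by have := loop_step gP i; rewrite gentle_stepE => /andP[]. Qed.

Lemma tailE i : tail (g i) = v i + dir (a i).
Proof. by rewrite /v /a /tip dir_opp addrK. Qed.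

Lemma next_tip i : v i.+1 = v i + dir (b i).
Proof. by rewrite -(tail_next i). Qed.

Lemma loop_interior i : interior n (v i).
Proof.
have /and5P[h1 h2 h3 h4 _] := loop_flanked gP i.
have /and5P[h5 h6 h7 h8 _] := loop_flanked gP i.+1.
split=> // k; move: k; rewrite tail_next -/(b i) in h5 h7 h8.
rewrite tailE in h1 h3 h4; rewrite -/(v i.+1) next_tip in h6.
apply: (all_rays_from_passage (T := fun k => in_triangle n (v i + dir k))
  (loop_turn i)) => //.
- by move=> k; apply: in_triangle_between.
- rewrite /a; move: h4; rewrite -addrA; congr (in_triangle n (_ + _)).
  by rewrite /a; by_rays ((g i).2).
- move: h3; rewrite -addrA; congr (in_triangle n (_ + _)).
  by rewrite /a; by_rays ((g i).2).
Qed.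

Lemma loop_passage i : passage (s i) (a i) (b i).
Proof.
rewrite /passage loop_turn andbT -(region_tip labP (loop_flanked gP i)).
rewrite (loop_region gP) /=.
by have := loop_region gP i.+1; rewrite /region tail_next.
Qed.

Lemma loop_star i : star_ok (s i).
Proof. exact/(interior_star labP)/loop_interior. Qed.

Lemma loop_periodM i k : g (i + k * L)%N = g i.
Proof. by elim: k => [|k IH]; rewrite ?addn0 // mulSnr addnA (loop_period gP). Qed.

(** Otherwise the edges from i + 1 to i + m would form a shorter loop. *)
Lemma no_shortcut i m : (0 < m < L)%N -> ~~ gentle_step (g (i + m)%N) (g i.+1).
Proof.
move=> /andP[m_gt0 lt_m]; apply/negP=> st.
suff /minL : loop n lab m (fun t => g (i.+1 + t %% m)%N) by rewrite leqNgt lt_m.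
apply: (loop_of_path (f := fun t => g (i.+1 + t)%N)) => //.
- by move=> t _; apply: (loop_region gP).
- by move=> t _; apply: (loop_flanked gP).
- by move=> t _; rewrite addnS; apply: (loop_step gP).
by rewrite addn0 (_ : i.+1 + m.-1 = i + m)%N //; lia.
Qed.

Lemma no_chord_shortcut i m e : (m.+1 < L)%N -> region lab e -> flanked n e ->
  gentle_step (g (i + m)%N) e -> gentle_step e (g i.+1) -> (0 < m)%N -> False.
Proof.
move=> lt_m e_reg e_fl st1 st2 m_gt0.
pose f t := if (t < m)%N then g (i.+1 + t)%N else e.
suff /minL : loop n lab m.+1 (fun t => f (t %% m.+1)%N) by rewrite leqNgt lt_m.
apply: loop_of_path => //; rewrite /f.
- by move=> t _; case: ifP => // _; apply: (loop_region gP).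
- by move=> t _; case: ifP => // _; apply: (loop_flanked gP).
- move=> t; rewrite ltnS => lt_t; rewrite lt_t; case: ltnP => lt_t1.
    by rewrite addnS; apply: (loop_step gP).
  by rewrite (_ : i.+1 + t = i + m)%N //; lia.
by rewrite /= ltnn m_gt0 addn0.
Qed.

(** If the loop met a vertex twice, reconnecting the strands by [swap_passages]
    would split off a shorter loop. *)
Lemma tip_neq i m : (0 < m < L)%N -> v i != v (i + m)%N.
Proof.
move=> /andP[m_gt0 lt_m]; apply/eqP=> e_v.
have := loop_passage (i + m)%N; rewrite /s -e_v => p'.
have := swap_passages (size_around lab (v i)) (loop_star i) (loop_passage i) p'.
case/orP=> push.
- have /negP[] : ~~ gentle_step (g (i + m + (L - m))%N) (g (i + m).+1).
    by apply: no_shortcut; lia.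
  rewrite -addnA subnKC 1?ltnW // (loop_period gP) gentle_stepE tail_next -e_v eqxx.
  exact: push.
- have /negP[] : ~~ gentle_step (g (i + m)%N) (g i.+1) by apply: no_shortcut; lia.
  by rewrite gentle_stepE tail_next -/(v (i + m)) -e_v eqxx.
Qed.

Lemma prev_tip i : tail (g i) = v (i + L.-1)%N.
Proof.
by rewrite -tail_next -addnS prednK ?(loop_gt0 gP) // (loop_period gP).
Qed.

(** A chord is not an edge of the loop, and its ends are not two steps apart:
    two gentle steps lead to a distance greater than 1. *)
Lemma chord_off_loop m i t : (2 <= m)%N -> (m + 2 <= L)%N ->
  v (i + m)%N = v i + dir t ->
  [/\ t != a i, t != b i, t + 3 != a (i + m)%N, t + 3 != b (i + m)%N & (m != 2)%N].
Proof.
move=> m_ge2 m_leL; set w := v (i + m)%N => w_def.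
have v_def : v i = w + dir (t + 3) by rewrite w_def dir_opp addrK.
have prev_w : tail (g (i + m)%N) = v (i + m.-1)%N.
  by rewrite -tail_next -addnS prednK // ltnW.
have tb : t != b i.
  apply: contraNneq (@tip_neq i.+1 m.-1 _) => [e_t|];
    last by clear -m_ge2 m_leL; lia.
  by rewrite addSnnS prednK 1?ltnW // -/w w_def e_t next_tip.
have ta : t != a i.
  apply: contraNneq (@tip_neq (i + m) (L.-1 - m) _) => [e_t|];
    last by clear -m_ge2 m_leL; lia.
  by rewrite -addnA subnKC -?prev_tip ?tailE -?e_t -?w_def //; clear -m_ge2 m_leL; lia.
have tb' : t + 3 != b (i + m)%N.
  apply: contraNneq (@tip_neq (i + m).+1 (L - m.+1) _) => [e_t|];
    last by clear -m_ge2 m_leL; lia.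
  rewrite (_ : (i + m).+1 + (L - m.+1) = i + L)%N; last by clear -m_ge2 m_leL; lia.
  by rewrite [X in _ == X]/v (loop_period gP) next_tip -/w -e_t -v_def.
have ta' : t + 3 != a (i + m)%N.
  apply: contraNneq (@tip_neq i m.-1 _) => [e_t|];
    last by clear -m_ge2 m_leL; lia.
  by rewrite -prev_w tailE -/w -e_t -v_def.
have m_neq2 : (m != 2)%N.
  apply: contraNneq (@two_steps (b i) (b i.+1) t _) => [e_m|].
    by move: w_def; rewrite /w e_m addn2 !next_tip -addrA => /addrI ->.
  by have /andP[] := loop_step gP i.+1.
by split.
Qed.

(** Descent on the length m of the arc between the ends of the chord, on the
    face that lies on the side of this arc. *)
Lemma no_labelled_chord c m i t : (2 <= m)%N -> (m + 2 <= L)%N ->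
  v (i + m)%N = v i + dir t -> lab (v i, t) = Some c -> False.
Proof.
elim/ltn_ind: m i t => m IH i t m_ge2 m_leL w_def lab_t.
set w := v (i + m)%N in w_def.
have v_def : v i = w + dir (t + 3) by rewrite w_def dir_opp addrK.
have v_in := loop_interior i; have w_in := loop_interior (i + m).
have p := loop_passage i; have p' := loop_passage (i + m)%N.
have r := loop_star i; have r' := loop_star (i + m)%N.
have s6 : size (s i) = 6%N := size_around _ _.
have s6' : size (s (i + m)%N) = 6%N := size_around _ _.
have lab_t' : lab (w, t + 3) = Some c by rewrite w_def (lab_rev labP).
have prev_w : tail (g (i + m)%N) = v (i + m.-1)%N.
  by rewrite -tail_next -addnS prednK // ltnW.
have [ta tb ta' tb' m_neq2] := chord_off_loop m_ge2 m_leL w_def.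
have at_v k : at_ray (s i) k = lab (v i, k) := at_around lab (v i) k.
have at_w k : at_ray (s (i + m)%N) k = lab (w, k) := at_around lab w k.
have := chord_face labP v_in lab_t; rewrite -w_def.
(* The face between the chord and the arc from i to i + m. *)
case: ifP => [/eqP rh_v rh_w|_ [tr_v tr_w tr_x]].
  have b_def := chord_rhombus_out s6 r p ta tb (etrans (at_v t) lab_t)
    (etrans (at_v _) rh_v).
  have a_def := chord_rhombus_in s6' r' p' ta' tb' (etrans (at_w _) lab_t')
    (etrans (at_w _) rh_w).
  have far : lab (v i.+1, t) = Some c.
    rewrite next_tip b_def; apply: (chord_far_edge labP); rewrite -w_def //.
  have w_prev : v (i + m.-1)%N = v i.+1 + dir t.
    rewrite -prev_w tailE a_def -/w w_def next_tip b_def; apply: two_hops.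
    by case: (c); by_rays t.
  (* For m = 3 the opposite side of the rhombus is the middle edge of the arc,
     and the arc would turn by 180 degrees in two steps. *)
  have [m3|m_neq3] := eqVneq m 3%N.
    have b1 : b i.+1 = t.
      apply: dir_inj; apply: (addrI (v i.+1)).
      by rewrite -w_prev -next_tip m3 /= addn2.
    have : gentle_turn (a i.+2) (b i.+2) := loop_turn _.
    move: a_def; rewrite m3 addn3 /a => /(canRL (addrK _)) a_def.
    rewrite /a -/(b i.+1) b1 /b a_def.
    by case: (c); generalize t; apply: Z6_ind; vm_compute.
  apply: (IH m.-2 _ i.+1 t) => //; try by clear -m_ge2 m_leL m_neq2 m_neq3; lia.
  by rewrite (_ : i.+1 + m.-2 = i + m.-1)%N //; lia.
have [b_def|b_def] := eqVneq (b i) (t - sense c).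
  apply: (IH m.-1 _ i.+1 (t + sense c)); try by clear -m_ge2 m_leL m_neq2; lia.
    rewrite (_ : i.+1 + m.-1 = i + m)%N; last by clear -m_ge2; lia.
    rewrite -/w w_def next_tip b_def; apply/esym/one_hop.
    by case: (c); by_rays t.
  by rewrite next_tip b_def.
have [a_def|a_def] := eqVneq (a (i + m)%N) (t + 3 + sense c).
  apply: (IH m.-1 _ i (t - sense c)) => //; try by clear -m_ge2 m_leL m_neq2; lia.
  rewrite -prev_w tailE a_def -/w w_def; apply: one_hop.
  by case: (c); by_rays t.
have := chord_triangle_in s6' r' p' ta' tb' (etrans (at_w _) lab_t')
    (etrans (at_w _) tr_w) a_def.
case/andP=> /eqP b'_def /implyP turn_w.
have := chord_triangle_out s6 r p ta tb (etrans (at_v _) lab_t)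
    (etrans (at_v _) tr_v) b_def.
case/orP=> [/eqP a'_def | /andP[in_t turn_v]].
  (* The loop leaves the end w and arrives at v i along the two edges of the
     face behind the chord, hence through the third vertex of this face. *)
  have meet : v (i + m).+1 = v (i + L.-1)%N.
    rewrite -prev_tip tailE a'_def next_tip b'_def -/w w_def; apply: one_hop.
    by case: (c); by_rays t.
  have [m_eq|m_neq] := eqVneq m (L - 2)%N.
    have : gentle_turn (a (i + m).+1) (b (i + m).+1) := loop_turn _.
    have -> : b (i + m).+1 = (g i).2.
      rewrite /b -(loop_period gP i); congr (g _).2; clear -m_leL m_eq; lia.
    rewrite /a -/(b (i + m)%N) b'_def (canRL (addrK _) a'_def).
    by case: (c); generalize t; apply: Z6_ind; vm_compute.
  have /negP[] : v (i + m).+1 != v ((i + m).+1 + (L.-1 - m.+1))%N.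
    by apply: tip_neq; clear -m_leL m_neq; lia.
  rewrite meet (_ : (i + m).+1 + (L.-1 - m.+1) = i + L.-1)%N ?eqxx //.
  by clear -m_leL m_neq; lia.
(* The chord, traversed from i + m to i, replaces the other arc of the loop. *)
pose e : dedge := (w, t + 3).
have e_fl : flanked n e.
  have [w_tri w_nbr] := w_in.
  by rewrite /flanked /e /= /tip /tail /= w_tri !w_nbr.
have e_tip : tip e = v i by rewrite v_def.
have e_reg : region lab e.
  rewrite (region_tip labP e_fl) e_tip /=.
  by rewrite (_ : t + 3 + 3 = t) //; by_rays t.
apply: (@no_chord_shortcut i m e) => //; try by clear -m_ge2 m_leL m_neq2; lia.
- rewrite gentle_stepE /= -/(v (i + m)%N) eqxx /=.
  exact: turn_w.
- rewrite gentle_stepE e_tip tail_next eqxx /=.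
  by rewrite (_ : t + 3 + 3 = t) //; by_rays t.
Qed.

(** The remaining chords are short diagonals of rhombi. The loop arrives at the
    end of the diagonal along a side of the rhombus, so the tail of that edge is
    joined to the other end of the diagonal by another side of the rhombus,
    which is a labelled chord. *)
Lemma no_chord m i t : (2 <= m)%N -> (m + 2 <= L)%N -> v (i + m)%N != v i + dir t.
Proof.
move=> m_ge2 m_leL; apply/eqP=> w_def.
case lab_t: (lab (v i, t)) => [c|].
  exact: (no_labelled_chord m_ge2 m_leL w_def lab_t).
have [ta tb ta' tb' m_neq2] := chord_off_loop m_ge2 m_leL w_def.
have lab_t' : lab (v (i + m)%N, t + 3) = None by rewrite w_def (lab_rev labP).
have [r1 r5 _] := chord_diagonal (size_around lab (v i)) (loop_star i)
  (loop_passage i) ta tb (etrans (at_around lab _ _) lab_t).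
have [_ _ a'_def] := chord_diagonal (size_around lab _) (loop_star (i + m))
  (loop_passage (i + m)%N) ta' tb' (etrans (at_around lab _ _) lab_t').
rewrite !at_around in r1 r5.
have prev_w : v (i + m.-1)%N = v i + dir t + dir (a (i + m)%N).
  by rewrite -w_def -tailE -tail_next -addnS prednK // ltnW.
have [m_ge3 le_m] : (2 <= m.-1)%N /\ (m.-1 + 2 <= L)%N.
  by clear -m_ge2 m_leL m_neq2; lia.
case/orP: a'_def prev_w => /eqP-> prev_w.
  apply: (no_labelled_chord m_ge3 le_m _ r1); rewrite prev_w.
  by apply: one_hop; by_rays t.
apply: (no_labelled_chord m_ge3 le_m _ r5); rewrite prev_w.
by apply: one_hop; by_rays t.
Qed.

(** * The breathing of a loop *)

Definition loop_vertices : seq point := [seq v i | i <- iota 0 L].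

Lemma mod_period i : g i = g (i %% L)%N.
Proof. by rewrite {1}(divn_eq i L) addnC loop_periodM. Qed.

Lemma tip_inj i j : (i < L)%N -> (j < L)%N -> v i = v j -> i = j.
Proof.
wlog le_ij : i j / (i <= j)%N => [wl|] lt_i lt_j e_v.
  by have [/wl->|/ltnW/wl<-] := leqP i j.
apply/eqP; rewrite eqn_leq le_ij leqNgt; apply/negP=> lt_ij.
have /negP[] : v i != v (i + (j - i))%N by apply: tip_neq; lia.
by rewrite subnKC // e_v.
Qed.

Lemma tip_on_loop i : v i \in loop_vertices.
Proof.
rewrite /v mod_period; apply: map_f; rewrite mem_iota /= ltn_mod.
exact: loop_gt0 gP.
Qed.

Lemma on_loopP p : reflect (exists i, p = v i) (p \in loop_vertices).
Proof.
apply: (iffP idP) => [/mapP[i _ ->]|[i ->]]; [by exists i | exact: tip_on_loop].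
Qed.

Definition shift (p : point) : point :=
  let i := index p loop_vertices in
  if (i < L)%N then dir (push (s i) (a i)) else 0.

Lemma shift_tip i : shift (v i) = dir (push (s i) (a i)).
Proof.
have size_v : size loop_vertices = L by rewrite size_map size_iota.
rewrite /shift; set j := index _ _.
have lt_j : (j < L)%N by rewrite -size_v index_mem tip_on_loop.
have e_v : v j = v (i %% L)%N.
  have := nth_index 0 (tip_on_loop i).
  rewrite (nth_map 0%N) ?size_iota // nth_iota // add0n -/j => ->.
  by rewrite /v mod_period.
have lt_i : (i %% L < L)%N by rewrite ltn_mod (loop_gt0 gP).
by rewrite lt_j (tip_inj lt_j lt_i e_v) /s /v /a -mod_period.
Qed.

Lemma shift_off p : p \notin loop_vertices -> shift p = 0.
Proof. by move=> /memNindex; rewrite /shift size_map size_iota => ->; rewrite ltnn. Qed.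

(** Besides its two neighbours on the loop, no lattice point at distance 1 from
    a loop vertex is on the loop. *)
Lemma side_off_loop i k : k != a i -> k != b i -> v i + dir k \notin loop_vertices.
Proof.
move=> ka kb; apply/on_loopP=> -[j e_w].
have [m lt_m {}e_w] : exists2 m, (m < L)%N & v i + dir k = v (i + m)%N.
  have le_ij : (i <= j + i * L)%N by have := loop_gt0 gP; clear; nia.
  exists ((j + i * L - i) %% L)%N; first by rewrite ltn_mod (loop_gt0 gP).
  rewrite e_w /v -(loop_periodM j i) -{1}(subnKC le_ij).
  rewrite {1}(divn_eq (j + i * L - i) L) [(_ * L + _)%N]addnC addnA.
  by rewrite loop_periodM.
case: m lt_m e_w => [|[|m]] lt_m e_w.
- by move: (dir_neq0 k); rewrite -(inj_eq (addrI (v i))) e_w addn0 addr0 eqxx.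
- by move: e_w; rewrite addn1 next_tip => /addrI/dir_inj/eqP; apply/negP.
have [le_m|] := leqP (m.+2 + 2) L.
  by have /negP[] := @no_chord m.+2 i k isT le_m; rewrite e_w.
move=> gt_m; have m_eq : m.+2 = L.-1 by clear -lt_m gt_m; lia.
by move: e_w; rewrite m_eq -prev_tip tailE => /addrI/dir_inj/eqP; apply/negP.
Qed.

(** The increment along an edge after the heights of the loop vertices have been
    moved. *)
Definition moved (e : dedge) : point :=
  displacement (lab e) e.2 + shift (tip e) - shift (tail e).

Definition breathed (e : dedge) : label := label_at e.2 (moved e).

Lemma tip_opp e : tip (opp_edge e) = tail e.
Proof. by rewrite /opp_edge /tip /= dir_opp addrK. Qed.

Lemma opp_edgeK e : opp_edge (opp_edge e) = e.
Proof.
rewrite {1}/opp_edge tip_opp; case: e => p k /=.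
by congr (_, _); by_rays k.
Qed.

Lemma moved_opp e : moved (opp_edge e) = - moved e.
Proof.
rewrite /moved (lab_opp labP) displacement_opp tip_opp -[tail (opp_edge e)]/(tip e).
by rewrite opprB opprD addrA [_ - displacement _ _]addrC.
Qed.

Lemma breathed_opp e : breathed (opp_edge e) = breathed e.
Proof. by rewrite /breathed moved_opp label_at_opp. Qed.

(** The moved increment is the displacement of an admissible label. *)
Definition aligned e := displacement (breathed e) e.2 == moved e.

Lemma breathed_eq e l : displacement l e.2 = moved e -> breathed e = l.
Proof. by rewrite /breathed => <-; rewrite displacementK. Qed.

Lemma alignedP e l : displacement l e.2 = moved e -> aligned e.
Proof. by rewrite /aligned => e_l; rewrite (breathed_eq e_l) e_l. Qed.

Lemma aligned_opp e : aligned (opp_edge e) = aligned e.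
Proof. by rewrite /aligned moved_opp breathed_opp displacement_opp eqr_opp. Qed.

Lemma breathed_side i k : k != a i -> k != b i ->
  exists2 l, displacement l k = moved (v i, k) & l != lab (v i, k).
Proof.
move=> ka kb; have := shift_off (side_off_loop ka kb).
rewrite /moved /tip /= => ->; rewrite addr0 shift_tip.
have := push_side (size_around lab _) (loop_star i) (loop_passage i) ka kb.
rewrite at_around; case: (lab _) => [[]|]; rewrite !inE => /orP[] /eqP->.
- by exists None => //; by_rays k.
- by exists (Some false) => //; by_rays k.
- by exists (Some true) => //; by_rays k.
- by exists None => //; by_rays k.
- by exists (Some false) => //; by_rays k.
- by exists (Some true) => //; by_rays k.
Qed.

Lemma breathed_along i : exists c, displacement (Some c) (b i) = moved (g i.+1).
Proof.
rewrite /moved tail_next -/(v i.+1) !shift_tip -/(b i) {1}/push.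
have -> : a i.+1 = b i + 3 by [].
have -> : at_ray (s i.+1) (b i + 3) = lab (g i.+1).
  rewrite at_around -(lab_opp labP (g i.+1)); congr lab.
have lab_loop : lab (g i.+1) != None.
  have := loop_region gP i.+1.
  rewrite /region /out_ray !at_around /=; case: (g i.+1) => p k /=.
  by case: (lab (p, k)) => [//|]; rewrite !inE !xpair_eqE !andbF.
have := push_along (size_around lab _) (loop_star i) (loop_passage i).
move: (lab _) lab_loop (push (s i) (a i)) => l l_neq t; rewrite !inE.
case: l l_neq => [[]|//] _ /orP[] /eqP-> /=;
  first [by exists true; by_rays (b i) | by exists false; by_rays (b i)].
Qed.

Lemma breathed_loop i : aligned (g i) /\ breathed (g i) != None.
Proof.
rewrite -(loop_period gP i) -(prednK (loop_gt0 gP)) addnS.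
have [c e_c] := breathed_along (i + L.-1)%N.
by rewrite (alignedP e_c) (breathed_eq e_c).
Qed.

Lemma loop_edge_in i : (v i, a i) = opp_edge (g i). Proof. by []. Qed.

Lemma loop_edge_out i : (v i, b i) = g i.+1.
Proof. by rewrite -tail_next /b; case: (g _). Qed.

Lemma breathed_aligned e : aligned e.
Proof.
have from_loop i k : aligned (v i, k).
  have [->|ka] := eqVneq k (a i).
    by rewrite loop_edge_in aligned_opp; have [] := breathed_loop i.
  have [->|kb] := eqVneq k (b i).
    by rewrite loop_edge_out; have [] := breathed_loop i.+1.
  by have [l e_l _] := breathed_side ka kb; apply: (@alignedP (v i, k) l).
have from_tail f : tail f \in loop_vertices -> aligned f.
  by case: f => p k /on_loopP[i /= ->].
have [/from_tail //|tail_off] := boolP (tail e \in loop_vertices).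
have [tip_on|tip_off] := boolP (tip e \in loop_vertices).
  by rewrite -aligned_opp; apply: from_tail.
by apply: (@alignedP e (lab e)); rewrite /moved !shift_off // addr0 subr0.
Qed.

Lemma breathed_off e : tail e \notin loop_vertices -> tip e \notin loop_vertices ->
  breathed e = lab e.
Proof.
by move=> *; apply: breathed_eq; rewrite /moved !shift_off // addr0 subr0.
Qed.

(** A spurious face with a corner on the loop would have its other corners off
    the loop, as the edges of the loop do not become diagonals. So its opposite
    edge was a diagonal before, and the corner was an acute angle, which
    [push_corner] excludes. *)
Lemma loop_vertex_no_diagonals i k :
  [/\ breathed (v i, k) = None, breathed (v i + dir k, k + 2) = None
    & breathed (v i, k + 1) = None] -> False.
Proof.
move=> [br1 br2 br3].
have not_ab j : breathed (v i, j) = None -> (j != a i) && (j != b i).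
  move=> br; apply/andP; split; apply: contra_eqN br => /eqP->.
    by rewrite loop_edge_in breathed_opp; have [] := breathed_loop i.
  by rewrite loop_edge_out; have [] := breathed_loop i.+1.
have /andP[ka kb] := not_ab _ br1; have /andP[ka' kb'] := not_ab _ br3.
have off1 := side_off_loop ka kb; have off3 := side_off_loop ka' kb'.
have e_tip : tip (v i + dir k, k + 2) = v i + dir (k + 1).
  by apply: one_hop; by_rays k.
rewrite breathed_off // ?e_tip // in br2.
have := interior_face labP k (loop_interior i); rewrite br2 => lab_f.
have [r1 r2] : lab (v i, k) = Some true /\ lab (v i, k + 1) = Some false.
  by move: lab_f; case: (lab _) => [[]|]; case: (lab _) => [[]|].
have /negP[] := push_corner (size_around lab _) (loop_star i) (loop_passage i)
  ka kb ka' kb' (etrans (at_around lab _ _) r1) (etrans (at_around lab _ _) r2).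
have := breathed_aligned (v i, k); rewrite /aligned br1 /moved r1 /=.
rewrite shift_off // shift_tip addr0 sub0r => /eqP/esym/eqP.
rewrite eqr_oppLR -dir_opp => /eqP/dir_inj->.
by apply/eqP; by_rays k.
Qed.

(** The moved increments of a face still sum to zero. *)
Lemma breathed_face p k : in_triangle n p -> in_triangle n (p + dir k) ->
  in_triangle n (p + dir (k + 1)) ->
  (breathed (p, k), breathed (p + dir k, k + 2), breathed (p, k + 1)) \in faces.
Proof.
move=> p_in q_in r_in; have lab_f := lab_face labP p_in q_in r_in.
have qr : p + dir k + dir (k + 2) = p + dir (k + 1) by apply: one_hop; by_rays k.
have closed : displacement (breathed (p, k)) k +
    displacement (breathed (p + dir k, k + 2)) (k + 2) =
    displacement (breathed (p, k + 1)) (k + 1).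
  have al e : displacement (breathed e) e.2 = moved e by exact/eqP/breathed_aligned.
  rewrite [LHS](congr2 +%R (al (p, k)) (al (p + dir k, k + 2))) (al (p, k + 1)).
  rewrite /moved /tip /tail /= qr -(faces_displacement k lab_f).
  move: (displacement (lab (p, k)) k) => x; move: (displacement _ _) => y.
  move: (shift (p + dir k)) => d1; move: (shift p) => d2; move: (shift _) => d3.
  rewrite [x + d1 - d2]addrAC [y + d3 - d1]addrC addrA addrK.
  by rewrite [x - d2 + _]addrAC addrA.
case: (displacement_faces closed) => // -[no1 no2 no3]; exfalso.
have [/on_loopP[i p_def]|p_off] := boolP (p \in loop_vertices).
  by apply: (@loop_vertex_no_diagonals i k); rewrite -p_def.
have [/on_loopP[i q_def]|q_off] := boolP (p + dir k \in loop_vertices).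
  apply: (@loop_vertex_no_diagonals i (k + 2)); rewrite -q_def qr no2; split=> //.
    rewrite -no3 -[RHS]breathed_opp; congr (breathed (_, _)).
    by by_rays k.
  rewrite -no1 -[RHS]breathed_opp; congr (breathed (_, _)).
  by by_rays k.
have [/on_loopP[i r_def]|r_off] := boolP (p + dir (k + 1) \in loop_vertices).
  apply: (@loop_vertex_no_diagonals i (k + 4)); rewrite -r_def.
  rewrite (_ : p + dir (k + 1) + dir (k + 4) = p); last first.
    by rewrite -[RHS]addr0 -addrA; congr (_ + _); by_rays k.
  split.
  - rewrite -no3 -[RHS]breathed_opp; congr (breathed (_, _)).
    by by_rays k.
  - by rewrite -no1; congr (breathed (_, _)); by_rays k.
  rewrite -no2 -[RHS]breathed_opp; congr (breathed (_, _)) => //.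
  by by_rays k.
rewrite !breathed_off /tip /tail ?qr // in no1 no2 no3.
by move: lab_f; rewrite no1 no2 no3.
Qed.

Lemma outer_edge_off e : e \in outer_edges n ->
  tail e \notin loop_vertices /\ tip e \notin loop_vertices.
Proof.
(* An interior vertex has positive distance from the three sides. *)
have inside p : p \in loop_vertices ->
    [&& 0 < p.1, 0 < p.2 & p.1 + p.2 < n%:Z].
  move=> /on_loopP[i ->]; have [_ nbr] := loop_interior i.
  move: (nbr 0) (nbr 3) (nbr 5); case: (v i) => x y.
  by rewrite /in_triangle /=; lia.
rewrite /outer_edges !mem_cat => /or3P[] /mapP[i]; rewrite mem_iota /= => lt_i ->;
  by split; apply: (contraNN (@inside _)) => /=; lia.
Qed.

Lemma breathed_outer e : e \in outer_edges n -> breathed e = lab e.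
Proof. by move=> /outer_edge_off[]; apply: breathed_off. Qed.

Lemma breathed_labelling : labelling n breathed.
Proof.
split; [exact: breathed_opp | exact: breathed_face | move=> e e_out].
by rewrite breathed_outer //; apply: (lab_outer labP).
Qed.

Lemma breathed_differs :
  exists p k, interior n p /\ breathed (p, k) != lab (p, k).
Proof.
(* The ray a + 1 is not on the loop, since a gentle passage leaves along one of
   the rays a + 2, a + 3 and a + 4. *)
exists (v 0%N), (a 0%N + 1); split; first exact: loop_interior.
have [||l e_l l_neq] := @breathed_side 0%N (a 0%N + 1).
- by generalize (a 0%N); apply: Z6_ind.
- have := loop_turn 0%N; rewrite /gentle_turn.
  by generalize (a 0%N) (b 0%N); apply: Z6_ind; apply: Z6_ind.
by rewrite (breathed_eq (e := (_, _)) e_l).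
Qed.

End Minimal.

(** Rigidity is expressed on the edges at interior vertices, which include edges
    whose label changes. *)
Theorem gentle_loop_breathes n lab L g : labelling n lab -> loop n lab L g ->
  ~ (forall lab', labelling n lab' -> {in outer_edges n, lab' =1 lab} ->
     forall p k, interior n p -> lab' (p, k) = lab (p, k)).
Proof.
move=> labP gP rigid; elim/ltn_ind: L g gP => L IH g gP.
have minL L' g' : loop n lab L' g' -> (L <= L')%N.
  by move=> gP'; rewrite leqNgt; apply/negP=> lt_L'; apply: IH gP'.
have [p [k [p_in /eqP[]]]] := breathed_differs labP gP minL.
apply: rigid p_in; first exact: breathed_labelling.
by move=> e; apply: breathed_outer.
Qed.

(** * Faces, corners and pieces *)

(** The corner of a face at the vertex p, between the rays k and k + 1. Each
    face has three corners, and so three names of this kind. *)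
Notation sector := (point * 'Z_6)%type.

Definition sector_vertices (x : sector) : seq point :=
  [:: x.1; x.1 + dir x.2; x.1 + dir (x.2 + 1)].

(** When the corner is an acute angle of a rhombus, this edge is the short
    diagonal. *)
Definition opposite_edge (x : sector) : dedge := (x.1 + dir x.2, x.2 + 2).

Definition next_corner (x : sector) : sector := (x.1 + dir x.2, x.2 + 2).

Definition corners (x : sector) : seq sector :=
  [:: x; next_corner x; next_corner (next_corner x)].

(** The opposite acute angle, when the corner is an acute angle of a rhombus. *)
Definition far (x : sector) : sector :=
  (x.1 + dir x.2 + dir (x.2 + 1), x.2 + 3).

Definition acute_edges (x : sector) : seq (dedge * bool) :=
  let: (p, k) := x in
  [:: ((p, k + 1), false);
      ((p + dir (k + 1), k), true);
      ((p + dir k + dir (k + 1), k + 4), false);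
      ((p + dir k, k + 3), true)].

Definition spoke (i : 'I_3) : 'Z_6 := inZp i.

Lemma I3_ind (Q : 'I_3 -> Prop) : Q (inord 0) -> Q (inord 1) -> Q (inord 2) ->
  forall i, Q i.
Proof.
move=> q0 q1 q2 [[|[|[|//]]] lt_i].
- by rewrite (_ : Ordinal lt_i = inord 0) //; apply: val_inj; rewrite /= inordK.
- by rewrite (_ : Ordinal lt_i = inord 1) //; apply: val_inj; rewrite /= inordK.
- by rewrite (_ : Ordinal lt_i = inord 2) //; apply: val_inj; rewrite /= inordK.
Qed.

Lemma spoke0 : spoke (inord 0) = 0. Proof. by apply: val_inj; rewrite /= inordK. Qed.
Lemma spoke1 : spoke (inord 1) = 1. Proof. by apply: val_inj; rewrite /= inordK. Qed.
Lemma spoke2 : spoke (inord 2) = 2. Proof. by apply: val_inj; rewrite /= inordK. Qed.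
Lemma spoke_inord (k : 'Z_6) : (k < 3)%N -> spoke (inord k) = k.
Proof. by move=> k3; apply: val_inj; rewrite /= inordK // modn_small. Qed.
Definition spokeE := (spoke0, spoke1, spoke2).

Lemma boundary_rhombus p i : boundary (Rhombus p i) = acute_edges (p, spoke i).
Proof. by []. Qed.

(** All corners of the faces that the piece covers. *)
Definition sectors (q : piece) : seq sector :=
  match q with
  | Triangle _ (p, up) => corners (p, cell_dir up)
  | Rhombus p i => corners (p, spoke i) ++ corners (far (p, spoke i))
  end.

Ltac decide_rays := repeat match goal with |- context [@eq_op _ ?a ?b] =>
  let T := type of a in unify T 'Z_6;
  let r := eval vm_compute in (@eq_op 'Z_6 a b) in
  change (@eq_op _ a b) with r end.

(** A piece is a union of one or two faces, so that a face whose vertices belong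
    to the piece is one of them: the four vertices of a rhombus span only two
    unit triangles. *)
Lemma sector_in_piece q x :
  {subset sector_vertices x <= vertices q} -> x \in sectors q.
Proof.
move=> sub; have : all (mem (vertices q)) (sector_vertices x) by apply/allP.
case: x {sub} => -[x y] k; case: q => [b [[z t] up]|[z t]].
  by case: up; move: k; apply: Z6_ind;
    rewrite /vertices /sector_vertices /= !inE !xpair_eqE /=; decide_rays; lia.
rewrite /vertices => i; rewrite boundary_rhombus /sectors.
by elim/I3_ind: i; rewrite ?spokeE; move: k; apply: Z6_ind;
  rewrite /sector_vertices /= !inE !xpair_eqE /=; decide_rays; lia.
Qed.

Lemma sector_vertices_next x :
  sector_vertices (next_corner x) = rot 1 (sector_vertices x).
Proof.
case: x => p k; rewrite /sector_vertices /next_corner /=.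
rewrite (@one_hop p k (k + 2) (k + 1)); last by by_rays k.
by rewrite (_ : k + 2 + 1 = k + 3) ?dir_opp ?addrK //; by_rays k.
Qed.

Lemma next_corner3 x : next_corner (next_corner (next_corner x)) = x.
Proof.
case: x => p k; rewrite /next_corner /=; congr (_, _); last by by_rays k.
by rewrite -!addrA -[RHS]addr0; congr (_ + _); by_rays k.
Qed.

Lemma corners_sym x y : x \in corners y -> y \in corners x.
Proof.
rewrite !inE => /or3P[] /eqP ->; rewrite ?eqxx //.
  by rewrite next_corner3 eqxx !orbT.
by rewrite next_corner3 eqxx orbT.
Qed.

Lemma corner_vertices x y : x \in corners y -> sector_vertices x =i sector_vertices y.
Proof.
rewrite !inE => /or3P[] /eqP -> // p; rewrite ?sector_vertices_next ?mem_rot //.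
Qed.

Lemma cell_of_sector x : exists c, x \in corners (c.1, cell_dir c.2).
Proof.
have at_k p k up : k = cell_dir up -> exists c, (p, k) \in corners (c.1, cell_dir c.2).
  by move=> ->; exists (p, up); apply: mem_head.
have shift y : (exists c, next_corner y \in corners (c.1, cell_dir c.2)) ->
    exists c, y \in corners (c.1, cell_dir c.2).
  case=> c y_c; exists c; move: y_c; rewrite !inE => /or3P[] /eqP e_y.
  - by rewrite -[y]next_corner3 e_y eqxx !orbT.
  - by rewrite -[y]next_corner3 e_y next_corner3 eqxx.
  - by rewrite -[y]next_corner3 e_y !next_corner3 eqxx orbT.
case: x => p; apply: Z6_ind.
- exact: (at_k p 0 true).
- exact: (at_k p 1 false).
- by do 2!apply: (shift _); apply: (at_k _ _ true); apply: val_inj.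
- by do 2!apply: (shift _); apply: (at_k _ _ false); apply: val_inj.
- by apply: (shift _); apply: (at_k _ _ true); apply: val_inj.
- by apply: (shift _); apply: (at_k _ _ false); apply: val_inj.
Qed.

Lemma acute_edges_far x : acute_edges (far x) = rot 2 (acute_edges x).
Proof.
case: x => p k; rewrite /far /acute_edges /= /rot /=.
have back : p + dir k + dir (k + 1) + dir (k + 3) = p + dir (k + 1).
  by rewrite addrAC dir_opp addrK.
have -> : k + 3 + 1 = k + 4 by by_rays k.
have back' : p + dir k + dir (k + 1) + dir (k + 4) = p + dir k.
  by rewrite -addrA (_ : dir (k + 1) + dir (k + 4) = 0) ?addr0 //; by_rays k.
rewrite back back' (_ : p + dir (k + 1) + dir (k + 4) = p); last first.
  by rewrite -addrA (_ : dir (k + 1) + dir (k + 4) = 0) ?addr0 //; by_rays k.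
do !congr cons; congr (_, _, _); by by_rays k.
Qed.

(** The rhombus with an acute angle at x. Exactly one of its two acute angles
    has a ray smaller than 3. *)
Definition rhomb (x : sector) : piece :=
  if (x.2 < 3)%N then Rhombus x.1 (inord x.2) else Rhombus (far x).1 (inord (x.2 - 3)).

Lemma rhomb_spoke p i : rhomb (p, spoke i) = Rhombus p i.
Proof. by elim/I3_ind: i; rewrite spokeE. Qed.

Lemma farK x : far (far x) = x.
Proof.
case: x => p k; rewrite /far /=; congr (_, _); last by by_rays k.
by rewrite -!addrA -[RHS]addr0; congr (_ + _); by_rays k.
Qed.

Lemma rhomb_far x : rhomb (far x) = rhomb x.
Proof.
have low p (k : 'Z_6) : (k < 3)%N -> rhomb (far (p, k)) = rhomb (p, k).
  move=> k3; rewrite /rhomb farK -[(far (p, k)).2]/(k + 3) -[(p, k).2]/k k3.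
  have -> : ((k + 3)%R < 3)%N = false by move: k3; elim/Z6_ind: k.
  congr (Rhombus _ (inord _)); move: k3; by elim/Z6_ind: k.
case: x => p k; have [/low//|k3] := boolP (k < 3)%N.
rewrite -{2}[(p, k)]farK [RHS]low //.
by move: k3; rewrite /far /=; elim/Z6_ind: k.
Qed.

Lemma boundary_rhomb x : boundary (rhomb x) =i acute_edges x.
Proof.
have low p i : boundary (rhomb (p, spoke i)) =i acute_edges (p, spoke i).
  by rewrite rhomb_spoke.
have low' p (k : 'Z_6) : (k < 3)%N -> boundary (rhomb (p, k)) =i acute_edges (p, k).
  by move=> /spoke_inord <-.
case: x => p k; have [/low'//|k3] := boolP (k < 3)%N.
move=> e; rewrite -rhomb_far low'; last by move: k3; rewrite /far /=; elim/Z6_ind: k.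
by rewrite -[(_, _)]/(far (p, k)) acute_edges_far mem_rot.
Qed.

Definition inside (n : nat) (q : piece) : bool := all (in_triangle n) (vertices q).

(** * Pieces that match a labelling *)

(** The piece occurs in the puzzle that the labelling describes. *)
Definition matches (lab : dedge -> label) (q : piece) : bool :=
  all (fun x => lab x.1 == Some x.2) (boundary q) &&
  (if q is Rhombus p i then lab (opposite_edge (p, spoke i)) == None else true).

Definition face (lab : dedge -> label) (x : sector) : label * label * label :=
  (lab x, lab (opposite_edge x), lab (x.1, x.2 + 1)).

Definition acute (lab : dedge -> label) (x : sector) : bool :=
  face lab x == (Some true, None, Some false).

Section Faces.
Variable lab : dedge -> label.
Hypothesis labN : forall e, lab (opp_edge e) = lab e.

Lemma lab_spoke v k : lab (v + dir k, k + 3) = lab (v, k).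
Proof. exact: (labN (v, k)). Qed.

Lemma face_next x :
  face lab (next_corner x) = ((face lab x).1.2, (face lab x).2, (face lab x).1.1).
Proof.
case: x => p k; rewrite /face /next_corner /opposite_edge /=; congr (_, _, _).
  rewrite (@one_hop p k (k + 2) (k + 1)); last by by_rays k.
  by rewrite (_ : k + 2 + 2 = k + 1 + 3) ?lab_spoke //; by_rays k.
by rewrite (_ : k + 2 + 1 = k + 3) ?lab_spoke //; by_rays k.
Qed.

Lemma opposite_edge_far x : lab (opposite_edge (far x)) = lab (opposite_edge x).
Proof.
case: x => p k; rewrite /far /opposite_edge /=.
rewrite addrAC dir_opp addrK -[RHS]lab_spoke; congr (lab (_, _)); last by by_rays k.
by apply/esym/one_hop; by_rays k.
Qed.

(** All labels of a rhombus can be read off from the faces at its two acute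
    angles. *)
Lemma matches_acute x :
  matches lab (rhomb x) = acute lab x && acute lab (far x).
Proof.
have -> : matches lab (rhomb x) =
    all (fun y => lab y.1 == Some y.2) (acute_edges x) && (lab (opposite_edge x) == None).
  rewrite /matches (eq_all_r (boundary_rhomb x)); congr (_ && _).
  have low i p : rhomb (p, spoke i) = Rhombus p i := rhomb_spoke p i.
  rewrite {1}/rhomb; case: ifP => [x3|x3].
    by rewrite spoke_inord //; case: (x).
  have e_k : (x.2 - 3 = (far x).2)%N by case: x x3 => p; apply: Z6_ind.
  have far3 : ((far x).2 < 3)%N by case: x x3 {e_k} => p; apply: Z6_ind.
  by rewrite e_k spoke_inord // -(opposite_edge_far x); case: (far x).
rewrite /acute /face !xpair_eqE opposite_edge_far.
case: x => p k; rewrite /far /acute_edges /= andbT.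
have -> : lab (p + dir k, k + 3) = lab (p, k) by rewrite lab_spoke.
have -> : lab (p + dir k + dir (k + 1), k + 3) = lab (p + dir (k + 1), k).
  by rewrite addrAC lab_spoke.
have -> : k + 3 + 1 = k + 4 by by_rays k.
by do ?[case: (_ == _) => //=].
Qed.

Lemma matches_triangle b p up :
  matches lab (Triangle b (p, up)) =
  (face lab (p, cell_dir up) == (Some b, Some b, Some b)).
Proof.
rewrite /matches /= !andbT; set k := cell_dir up.
rewrite /face /opposite_edge !xpair_eqE /= lab_spoke.
have -> : lab (p + dir (k + 1), k - 1) = lab (p + dir k, k + 2).
  rewrite -[RHS]lab_spoke (@one_hop p k (k + 2) (k + 1)); last by by_rays k.
  by congr (lab (_, _)); by_rays k.
by do ?[case: (_ == _) => //=].
Qed.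

Lemma face_corner x y : x \in corners y ->
  let: (a, b, c) := face lab y in face lab x \in [:: (a, b, c); (b, c, a); (c, a, b)].
Proof.
by rewrite !inE => /or3P[] /eqP ->; rewrite ?face_next; case: (face lab y) => [[? ?] ?];
  rewrite /= !inE eqxx ?orbT.
Qed.

Lemma face_corner_faces x y : x \in corners y ->
  (face lab x \in faces) = (face lab y \in faces).
Proof.
move=> /face_corner; case: (face lab y) (face lab x) => [[a b] c] f.
by rewrite !inE => /or3P[] /eqP ->; case: a b c => [[]|] [[]|] [[]|].
Qed.

Lemma sectors_rhomb q x : x \in sectors q -> matches lab q ->
  if q is Triangle b _ then face lab x = (Some b, Some b, Some b) else
  exists2 y, y \in corners x & acute lab y /\ q = rhomb y.
Proof.
case: q => [b [p up]|p i].
  rewrite -[sectors _]/(corners (p, cell_dir up)).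
  rewrite matches_triangle => /face_corner + /eqP f_c.
  by rewrite f_c !inE !orbb => /eqP.
rewrite -[sectors _]/(corners (p, spoke i) ++ corners (far (p, spoke i))).
rewrite mem_cat -rhomb_spoke matches_acute => x_pi /andP[ac_x ac_far].
case/orP: x_pi => /corners_sym x_pi; first by exists (p, spoke i).
by exists (far (p, spoke i)); rewrite ?rhomb_far.
Qed.

(** The three labels of an acute face are distinct, so only one of its corners
    is an acute angle of the rhombus. *)
Lemma acute_unique x y z : y \in corners x -> z \in corners x ->
  acute lab y -> acute lab z -> y = z.
Proof.
rewrite /acute !inE => /or3P[] /eqP -> /or3P[] /eqP -> //;
  rewrite ?face_next; case: (face lab x) => [[a b] c] /=;
  by case: a b c => [[]|] [[]|] [[]|].
Qed.

Lemma cell_unique p up p' up' x : (p, cell_dir up) \in corners x ->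
  (p', cell_dir up') \in corners x -> (p, up) = (p', up').
Proof.
move=> c_x c'_x; suff [-> e_k] : (p, cell_dir up) = (p', cell_dir up').
  by congr (_, _); case: up up' e_k {c_x c'_x} => [] [].
move: c_x c'_x; case: x => q k; rewrite !inE.
by move=> /or3P[] /eqP e /or3P[] /eqP e'; rewrite e e' //; exfalso;
  move/(congr1 snd): e; move/(congr1 snd): e'; case: up; case: up';
  rewrite /=; move: k; apply: Z6_ind.
Qed.

Lemma corner_edge x p k : x \in corners (p, k) ->
  [\/ (x.1, x.2 + 1) = (p, k + 1), (x.1, x.2 + 1) = (p + dir k, k + 3)
    | (x.1, x.2 + 1) = (p + dir (k + 1), k + 5)].
Proof.
rewrite !inE => /or3P[] /eqP ->; [apply: Or31 | apply: Or32 | apply: Or33] => //=.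
  by congr (_, _); by_rays k.
by rewrite (@one_hop p k (k + 2) (k + 1)); [congr (_, _) |]; by_rays k.
Qed.

Lemma matches_edge q x b : x \in sectors q -> matches lab q ->
  lab (x.1, x.2 + 1) = Some b -> ((x.1, x.2 + 1), b) \in boundary q.
Proof.
move=> x_q q_m lab_e.
have edge c : ((x.1, x.2 + 1), c) \in boundary q -> ((x.1, x.2 + 1), b) \in boundary q.
  move=> e_q; have /andP[/allP/(_ _ e_q)/=] := q_m.
  by rewrite lab_e => /eqP[->].
have := sectors_rhomb x_q q_m; case: q x_q q_m edge => [c [p up]|p i] x_q q_m edge.
  move=> _; apply: (edge c); case: (corner_edge x_q) => -> /=; rewrite !inE.
  - by rewrite eqxx.
  - by rewrite eqxx !orbT.
  by rewrite (_ : _ + 5 = cell_dir up - 1) ?eqxx ?orbT //; by_rays (cell_dir up).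
case=> -[p' k] y_x [ac_y q_y]; rewrite q_y in edge *.
case: (corner_edge (corners_sym y_x)) => e_x.
- by apply: (edge false); rewrite e_x boundary_rhomb /acute_edges !inE eqxx.
- by apply: (edge true); rewrite e_x boundary_rhomb /acute_edges !inE eqxx !orbT.
have : lab (opposite_edge (p', k)) = None by have /eqP[] := ac_y.
rewrite /opposite_edge /= -lab_spoke (@one_hop p' k (k + 2) (k + 1)); last by by_rays k.
by rewrite (_ : k + 2 + 3 = k + 5) -?e_x ?lab_e //; by_rays k.
Qed.

(** The labels of a face determine the piece that covers it: a triangle if the
    labels are equal, and otherwise the rhombus across the diagonal. *)
Lemma matches_unique q r x : x \in sectors q -> x \in sectors r ->
  matches lab q -> matches lab r -> q = r.
Proof.
move=> x_q x_r q_m r_m.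
have mixed y c : y \in corners x -> acute lab y ->
    face lab x = (Some c, Some c, Some c) -> False.
  move=> /face_corner + /eqP f_y f_x; rewrite f_x f_y !inE !orbb.
  by case: c {f_x} => /eqP.
have := sectors_rhomb x_r r_m; have := sectors_rhomb x_q q_m.
case: q r x_q x_r q_m r_m => [b [p up]|p i] [b' [p' up']|p' i'] x_q x_r q_m r_m.
- move=> -> [->]; have -> // : (p, up) = (p', up').
  by apply: (@cell_unique _ _ _ _ x); apply: corners_sym.
- by move=> f_x [y y_x [ac_y _]]; case: (mixed _ _ y_x ac_y f_x).
- by move=> [y y_x [ac_y _]] f_x; case: (mixed _ _ y_x ac_y f_x).
move=> [y y_x [ac_y ->]] [z z_x [ac_z ->]].
by rewrite (acute_unique y_x z_x ac_y ac_z).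
Qed.

End Faces.

Lemma sector_sub q x : x \in sectors q -> {subset sector_vertices x <= vertices q}.
Proof.
move=> x_q; have [y x_y y_q] : exists2 y, x \in corners y &
    {subset sector_vertices y <= vertices q}.
  case: q x_q => [b [p up]|p i] x_q.
    exists (p, cell_dir up) => // v; rewrite /vertices /= !inE.
    by case/or3P=> ->; rewrite ?orbT.
  have rh v : (v \in vertices (Rhombus p i)) =
      (v \in [seq tail y.1 | y <- acute_edges (p, spoke i)]) by [].
  move: x_q; rewrite -[sectors _]/(corners (p, spoke i) ++ corners (far (p, spoke i))).
  rewrite mem_cat => /orP[] x_q;
    [exists (p, spoke i) | exists (far (p, spoke i))] => // v.
    by rewrite rh /= !inE => /or3P[] ->; rewrite ?orbT.
  rewrite rh -[in X in _ -> X](mem_rot 2) -map_rot -acute_edges_far.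
  by case: (far _) => p' k; rewrite /= !inE => /or3P[] ->; rewrite ?orbT.
by move=> v; rewrite (corner_vertices x_y); apply: y_q.
Qed.

Definition right_face (e : dedge) : sector := (e.1, e.2 - 1).

Lemma right_faceK e : ((right_face e).1, (right_face e).2 + 1) = e.
Proof. by case: e => p k; rewrite /right_face /= subrK. Qed.

Lemma right_sector q e b : (e, b) \in boundary q -> right_face e \in sectors q.
Proof.
rewrite /right_face; case: q => [c [p up]|p i].
  rewrite /= -/(corners (p, cell_dir up)) !inE; move: (cell_dir up) => k.
  case/or3P=> /eqP[-> _] /=.
  - by rewrite addrK eqxx.
  - rewrite /next_corner /= (@one_hop p k (k + 2) (k + 1)); last by by_rays k.
    by rewrite (_ : k + 2 + 2 = k - 1 - 1) ?eqxx ?orbT //; by_rays k.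
  - by rewrite /next_corner /= (_ : k + 3 - 1 = k + 2) ?eqxx ?orbT //; by_rays k.
rewrite -[sectors _]/(corners (p, spoke i) ++ corners (far (p, spoke i))).
rewrite boundary_rhombus mem_cat; move: (spoke i) => k.
rewrite /acute_edges 4!inE => /or4P[] /eqP[-> _] /=.
- by rewrite addrK mem_head.
- apply/orP; right; rewrite /corners /next_corner /far /= !inE addrAC dir_opp addrK.
  by rewrite (_ : k + 3 + 2 = k - 1) ?eqxx ?orbT //; by_rays k.
- apply/orP; right; rewrite (_ : k + 4 - 1 = k + 3); last by by_rays k.
  exact: mem_head.
- apply/orP; left; rewrite /corners /next_corner /= !inE.
  by rewrite (_ : k + 3 - 1 = k + 2) ?eqxx ?orbT //; by_rays k.
Qed.

Lemma outer_edge_right n e : e \in outer_edges n ->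
  all (in_triangle n) (sector_vertices (right_face e)).
Proof.
rewrite /outer_edges !mem_cat => /or3P[] /mapP[i]; rewrite mem_iota /= => lt_i ->;
  rewrite /sector_vertices /right_face /in_triangle /=; lia.
Qed.

Lemma outer_edge_left n e : e \in outer_edges n ->
  ~~ in_triangle n (e.1 + dir (e.2 + 1)).
Proof.
rewrite /outer_edges !mem_cat => /or3P[] /mapP[i]; rewrite mem_iota /= => lt_i ->;
  rewrite /in_triangle /=; lia.
Qed.

(** The lattice triangle is convex and its sides are lattice lines, so the only
    edges with a face inside on the right and a face outside on the left are on
    the boundary. *)
Lemma inner_edge_left n e : all (in_triangle n) (sector_vertices (right_face e)) ->
  e \notin outer_edges n -> in_triangle n (e.1 + dir (e.2 + 1)).
Proof.
move=> tri; apply: contraR; rewrite /outer_edges !mem_cat.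
case: e tri => -[x y]; rewrite /right_face /sector_vertices /in_triangle.
apply: Z6_ind => /=;
  try lia.
- move=> tri out; apply/orP; left; apply/mapP; exists `|y|%N.
    by rewrite mem_iota; lia.
  by congr (_, _, _); lia.
- move=> tri out; apply/orP; right; apply/orP; right; apply/mapP; exists `|n%:Z - x|%N.
    by rewrite mem_iota; lia.
  by congr (_, _, _); lia.
- move=> tri out; apply/orP; right; apply/orP; left; apply/mapP; exists `|x|%N.
    by rewrite mem_iota; lia.
  by congr (_, _, _); lia.
Qed.

(** * From puzzles to labellings and back *)

Definition borders (q : piece) (e : dedge) (b : bool) : bool :=
  ((e, b) \in boundary q) || ((opp_edge e, b) \in boundary q).

Definition puzzle_label (P : {fset piece}) (e : dedge) : label :=
  let side b := has (fun q => borders q e b) (enum_fset P) in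
  if side false then Some false else if side true then Some true else None.

(** An outer edge is not a diagonal, as the rhombus would stick out of the
    triangle. *)
Lemma outer_edge_labelled n lab q e : e \in outer_edges n ->
  (forall e, lab (opp_edge e) = lab e) -> inside n q -> matches lab q ->
  right_face e \in sectors q -> lab e != None.
Proof.
move=> e_out labN q_in q_m x_q; apply/eqP=> lab_e.
have := sectors_rhomb labN x_q q_m.
case: q q_in q_m x_q => [b c|p i] q_in q_m x_q.
  by rewrite /face right_faceK lab_e.
case=> -[p' k] y_x [/eqP[ac1 ac2 ac3] q_y]; move: (corner_edge (corners_sym y_x)).
rewrite right_faceK; case=> e_y; rewrite e_y in lab_e.
- by rewrite lab_e in ac3.
- by rewrite (lab_spoke labN) ac1 in lab_e.
have /negP[] := outer_edge_left e_out; apply: (allP q_in).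
rewrite q_y /vertices; apply/mapP; exists ((p' + dir k + dir (k + 1), k + 4), false).
  by rewrite boundary_rhomb /acute_edges !inE eqxx !orbT.
rewrite e_y /tail /= (_ : k + 5 + 1 = k); last by by_rays k.
by rewrite addrAC.
Qed.

Section FromPuzzle.
Variables (n : nat) (P : {fset piece}).
Hypothesis puzP : is_puzzle n P.

Let inP q : q \in P -> inside n q. Proof. by case: puzP => [[inP _] _] /inP. Qed.

Lemma puzzle_piece_unique q r x : q \in P -> r \in P ->
  x \in sectors q -> x \in sectors r -> q = r.
Proof.
case: puzP => [[_ cov] _] q_P r_P x_q x_r.
have [c x_c] := cell_of_sector x.
have c_sub s : x \in sectors s -> covers s c.
  move=> /sector_sub sub v v_c; apply: sub; rewrite (corner_vertices x_c).
  by move: v_c; rewrite /cell_vertices.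
have [|s [_ uniq_s]] := cov c.
  by apply/allP=> v v_c; apply: (allP (inP q_P)); apply: (c_sub q x_q).
by rewrite -(uniq_s q) ?(uniq_s r) //; split=> //; apply: c_sub.
Qed.

Lemma puzzle_piece_exists x : all (in_triangle n) (sector_vertices x) ->
  exists2 q, q \in P & x \in sectors q.
Proof.
case: puzP => [[_ cov] _] x_in; have [c x_c] := cell_of_sector x.
have [|q [[q_P q_c] _]] := cov c.
  by apply/allP=> v v_c; apply: (allP x_in); rewrite (corner_vertices x_c).
exists q => //; apply: sector_in_piece => v.
by rewrite (corner_vertices x_c); apply: q_c.
Qed.

Lemma puzzle_label_opp e : puzzle_label P (opp_edge e) = puzzle_label P e.
Proof.
have side b : has (fun q => borders q (opp_edge e) b) (enum_fset P) =
    has (fun q => borders q e b) (enum_fset P).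
  by apply: eq_has => q; rewrite /borders opp_edgeK orbC.
by rewrite /puzzle_label !side.
Qed.

Lemma boundary_label_unique q e b b' :
  (e, b) \in boundary q -> (e, b') \in boundary q -> b = b'.
Proof.
case: q => [c [p up]|p i].
  by rewrite /= !inE => /or3P[] /eqP[_ ->] /or3P[] /eqP[_ ->].
rewrite boundary_rhombus /acute_edges !inE; move: (spoke i) => k; case: e => v j.
by move=> /or4P[] /eqP[_ e1 ->] /or4P[] /eqP[_ e2 ->] //; exfalso;
  move: e2; rewrite e1 => /eqP; apply/negP; move: (k); apply: Z6_ind.
Qed.

Lemma puzzle_labelW e c : puzzle_label P e = Some c ->
  exists2 q, q \in P & borders q e c.
Proof.
by rewrite /puzzle_label; case: hasP => [[q q_P q_e] [<-]|_]; [exists q |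
  case: hasP => [[q q_P q_e] [<-]|//]; exists q].
Qed.

Lemma diagonal_sectors p i e : e = opposite_edge (p, spoke i) ->
  right_face e \in sectors (Rhombus p i) /\
  right_face (opp_edge e) \in sectors (Rhombus p i).
Proof.
move=> ->.
rewrite -[sectors _]/(corners (p, spoke i) ++ corners (far (p, spoke i))) !mem_cat.
rewrite /right_face /opp_edge /tip /opposite_edge /=; move: (spoke i) => k.
rewrite (@one_hop p k (k + 2) (k + 1)); last by by_rays k.
split; apply/orP; [right | left]; rewrite /corners /next_corner /far /= !inE.
  have -> : p + dir k + dir (k + 1) + dir (k + 3) = p + dir (k + 1).
    by rewrite addrAC dir_opp addrK.
  have -> : p + dir (k + 1) + dir (k + 3 + 2) = p + dir k by apply: one_hop; by_rays k.
  by rewrite (_ : k + 3 + 2 + 2 = k + 2 - 1) ?eqxx ?orbT //; by_rays k.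
rewrite (@one_hop p k (k + 2) (k + 1)); last by by_rays k.
by rewrite (_ : k + 2 + 3 - 1 = k + 2 + 2) ?eqxx ?orbT //; by_rays k.
Qed.

Lemma diagonal_inner p i e c : e = opposite_edge (p, spoke i) ->
  borders (Rhombus p i) e c = false.
Proof.
move=> ->; rewrite /borders !boundary_rhombus /acute_edges /opp_edge /opposite_edge.
rewrite !inE !xpair_eqE /=.
by move: (spoke i) => k; elim/Z6_ind: k; rewrite !andbF.
Qed.

Lemma puzzle_labelP q e b : q \in P -> (e, b) \in boundary q ->
  puzzle_label P e = Some b.
Proof.
move=> q_P e_q; have side c : has (fun q => borders q e c) (enum_fset P) = (c == b).
  apply/hasP/eqP=> [[r r_P /orP[e_r|e_r]]|->].
  - have r_q := puzzle_piece_unique r_P q_P (right_sector e_r) (right_sector e_q).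
    by rewrite r_q in e_r; apply: boundary_label_unique e_r e_q.
  - by case: puzP => _ agree; apply/esym/(agree q r e).
  - by exists q; rewrite // /borders e_q.
by rewrite /puzzle_label !side; case: b {side e_q}.
Qed.

(** A piece with the diagonal of a rhombus on its boundary would cover one half
    of the rhombus, and so be the rhombus itself. *)
Lemma puzzle_matches q : q \in P -> matches (puzzle_label P) q.
Proof.
move=> q_P; apply/andP; split.
  by apply/allP=> -[e b] e_q; apply/eqP; apply: puzzle_labelP e_q.
case: q q_P => // p i q_P.
have [e e_d] : exists e, e = opposite_edge (p, spoke i) by eexists.
rewrite -e_d.
case lab_e: (puzzle_label P e) => [c|//]; have [r r_P e_r] := puzzle_labelW lab_e.
have [x_q x'_q] := diagonal_sectors e_d.
suff r_q : r = Rhombus p i by rewrite r_q (diagonal_inner _ e_d) in e_r.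
case/orP: e_r => /right_sector x_r.
  exact: puzzle_piece_unique r_P q_P x_r x_q.
exact: puzzle_piece_unique r_P q_P x_r x'_q.
Qed.

Lemma puzzle_labelling : labelling n (puzzle_label P).
Proof.
split; first exact: puzzle_label_opp.
  move=> p k p_in q_in r_in; rewrite -[(_, _, _)]/(face (puzzle_label P) (p, k)).
  have [|q q_P x_q] := @puzzle_piece_exists (p, k).
    by rewrite /sector_vertices /= p_in q_in r_in.
  have := sectors_rhomb puzzle_label_opp x_q (puzzle_matches q_P).
  case: q x_q {q_P} => [b c _ ->|p' i _ [y y_x [/eqP ac_y _]]]; first by case: b.
  by rewrite -(face_corner_faces puzzle_label_opp y_x) ac_y.
move=> e e_out; have [q q_P x_q] := puzzle_piece_exists (outer_edge_right e_out).
by apply: (outer_edge_labelled e_out puzzle_label_opp (inP q_P) (puzzle_matches q_P)).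
Qed.

Lemma puzzle_edge_label e b : all (in_triangle n) (sector_vertices (right_face e)) ->
  edge_label P e b <-> puzzle_label P e = Some b.
Proof.
move=> e_in; split=> [[q q_P]|lab_e]; first exact: puzzle_labelP.
have [q q_P x_q] := puzzle_piece_exists e_in; exists q => //.
rewrite -{1}(right_faceK e).
by apply: (matches_edge puzzle_label_opp x_q (puzzle_matches q_P)); rewrite right_faceK.
Qed.

Lemma sectors_corner q x y : x \in corners y -> y \in sectors q -> x \in sectors q.
Proof.
move=> x_y /sector_sub y_q; apply: sector_in_piece => v.
by rewrite (corner_vertices x_y); apply: y_q.
Qed.

Lemma puzzle_face q x : q \in P -> x \in sectors q ->
  face (puzzle_label P) x \in
    if kind q is Some b then [:: (Some b, Some b, Some b)]
    else [:: (Some true, None, Some false); (None, Some false, Some true);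
             (Some false, Some true, None)].
Proof.
move=> q_P x_q.
have := sectors_rhomb puzzle_label_opp x_q (puzzle_matches q_P).
case: q x_q {q_P} => [b c _ ->|p i _ [y y_x [/eqP ac_y _]]]; first by rewrite mem_head.
by have := face_corner puzzle_label_opp (corners_sym y_x); rewrite ac_y.
Qed.

(** The pieces on both sides of the edge determine the labels of their faces. *)
Lemma region_edge_region e : region_edge P e ->
  region (puzzle_label P) e /\ flanked n e.
Proof.
case: e => p k.
case=> q [r [[q_P /mapP[[f a] f_q /= e_f]] [r_P /mapP[[f' b] e_r /= e_f']]]].
move=> kinds sides.
rewrite -{f}e_f in f_q; rewrite -{f'}e_f' in e_r.
have x_r := right_sector e_r; rewrite /right_face /= in x_r.
have left_q := right_sector f_q.
have e_next : right_face (opp_edge (p, k)) = next_corner (p, k).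
  by rewrite /right_face /opp_edge /next_corner /=; congr (_, _); by_rays k.
have x_q : (p, k) \in sectors q.
  apply: sectors_corner left_q; rewrite e_next; apply: corners_sym.
  by rewrite !inE eqxx orbT.
have in_r v : v \in sector_vertices (p, k - 1) -> in_triangle n v.
  by move=> /(sector_sub x_r); apply/allP/inP.
have in_q v : v \in sector_vertices (p, k) -> in_triangle n v.
  by move=> /(sector_sub x_q); apply/allP/inP.
split; last first.
  rewrite /flanked /= /tip /tail /=; apply/and5P; split=> //.
  - by apply: in_q; rewrite !inE eqxx.
  - by apply: in_q; rewrite !inE eqxx orbT.
  - by apply: in_r; rewrite !inE eqxx orbT.
  - by apply: in_q; rewrite !inE eqxx !orbT.
have := puzzle_face q_P x_q; have := puzzle_face r_P x_r.
rewrite /region /out_ray !at_around /face /= subrK.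
case: (kind q) (kind r) kinds sides => [[]|] [[]|] // _ [] // _;
  rewrite !inE !xpair_eqE.
all: move: (puzzle_label P (p, k - 1)) (puzzle_label P (p, k))
    (puzzle_label P (p, k + 1)) (puzzle_label P (opposite_edge (p, k)))
    (puzzle_label P (opposite_edge (p, k - 1))).
all: by move=> [[]|] [[]|] [[]|] [[]|] [[]|].
Qed.

End FromPuzzle.

Section ToPuzzle.
Variables (n : nat) (lab : dedge -> label).
Hypothesis labP : labelling n lab.

(** A finite stock of pieces, among which those of the puzzle are selected. *)
Definition grid : seq point :=
  [seq (i%:Z, j%:Z) | i <- iota 0 n.+1, j <- iota 0 n.+1].

Definition candidates : seq piece :=
  [seq Triangle b c | b <- [:: false; true],
                      c <- [seq (p, up) | p <- grid, up <- [:: false; true]]] ++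
  [seq Rhombus p i | p <- grid, i <- enum 'I_3].

Definition puzzle_of : {fset piece} :=
  [fset q in [seq q <- candidates | inside n q && matches lab q]]%fset.

Lemma mem_grid p : in_triangle n p -> p \in grid.
Proof.
case: p => x y; rewrite /in_triangle /= => p_in; apply/allpairsP.
exists (`|x|%N, `|y|%N); split; rewrite ?mem_iota /=; try lia.
by congr (_, _); lia.
Qed.

Lemma mem_puzzle_of q : (q \in puzzle_of) = inside n q && matches lab q.
Proof.
rewrite in_fset mem_filter; apply/andb_idr => /andP[q_in _].
rewrite mem_cat; apply/orP.
case: q q_in => [b [p up]|p i] /andP[/mem_grid p_in _]; [left | right].
  apply: allpairs_f; first by case: (b).
  by apply: allpairs_f => //; case: (up).
by apply: allpairs_f; rewrite ?mem_enum.
Qed.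

Let labN := lab_opp labP.

Lemma face_of_triangle x : all (in_triangle n) (sector_vertices x) ->
  face lab x \in faces.
Proof. by case: x => p k /and4P[? ? ? _]; apply: (lab_face labP). Qed.

(** The diagonal is not on the boundary, as outer edges are labelled 0 or 1. So
    the face across the diagonal is inside the triangle, and the diagonal label
    forces its other labels. *)
Lemma rhomb_in_puzzle_of y : all (in_triangle n) (sector_vertices y) -> acute lab y ->
  rhomb y \in puzzle_of.
Proof.
case: y => p k y_in ac_y; have /and4P[/= p_in q_in r_in _] := y_in.
set f := opp_edge (opposite_edge (p, k)).
have f_def : f = (p + dir (k + 1), k + 5).
  rewrite /f /opp_edge /opposite_edge /tip /=; congr (_, _); last by by_rays k.
  by apply: one_hop; by_rays k.
have lab_f : lab f = None by rewrite /f labN; have /eqP[] := ac_y.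
have x_in : in_triangle n (p + dir k + dir (k + 1)).
  have -> : p + dir k + dir (k + 1) = f.1 + dir (f.2 + 1).
    by rewrite f_def /= addrAC; congr (_ + dir _); by_rays k.
  apply: inner_edge_left; last by apply/negP=> /(lab_outer labP); rewrite lab_f.
  have cn : right_face f \in corners (p, k).
    rewrite f_def /right_face /corners /next_corner /= !inE.
    rewrite (@one_hop p k (k + 2) (k + 1)); last by by_rays k.
    by rewrite (_ : k + 5 - 1 = k + 2 + 2) ?eqxx ?orbT //; by_rays k.
  by rewrite (eq_all_r (corner_vertices cn)).
have ac_far : acute lab (far (p, k)).
  have : face lab (far (p, k)) \in faces.
    apply: face_of_triangle; rewrite /sector_vertices /far /= x_in.
    rewrite addrAC dir_opp addrK r_in /= (_ : k + 3 + 1 = k + 4); last by by_rays k.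
    by rewrite -addrA (_ : dir (k + 1) + dir (k + 4) = 0) ?addr0 ?q_in //; by_rays k.
  rewrite /acute /face opposite_edge_far //.
  have -> : lab (opposite_edge (p, k)) = None by have /eqP[] := ac_y.
  by case: (lab _) => [[]|]; case: (lab _) => [[]|].
rewrite mem_puzzle_of matches_acute // ac_y ac_far !andbT.
apply/allP=> v /mapP[[e b]]; rewrite boundary_rhomb /acute_edges !inE.
by case/or4P=> /eqP[-> _] ->; rewrite /tail.
Qed.

Lemma puzzle_of_piece x : all (in_triangle n) (sector_vertices x) ->
  exists2 q, q \in puzzle_of & x \in sectors q.
Proof.
move=> x_in; have fx := face_of_triangle x_in.
have tri b : face lab x = (Some b, Some b, Some b) ->
    exists2 q, q \in puzzle_of & x \in sectors q.
  move=> f_x; have [[p up] x_c] := cell_of_sector x; exists (Triangle b (p, up)) => //.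
  rewrite mem_puzzle_of matches_triangle //; apply/andP; split.
    apply/allP=> v v_q; apply: (allP x_in); rewrite (corner_vertices x_c).
    by move: v_q; rewrite /vertices /= !inE => /or3P[] ->; rewrite ?orbT.
  by have := face_corner labN (corners_sym x_c); rewrite f_x !inE !orbb.
have rh y : y \in corners x -> acute lab y ->
    exists2 q, q \in puzzle_of & x \in sectors q.
  move=> y_x ac_y; exists (rhomb y).
    by apply: rhomb_in_puzzle_of => //; rewrite (eq_all_r (corner_vertices y_x)).
  apply: sector_in_piece => v; rewrite -(corner_vertices y_x); case: (y) => p k.
  move=> v_y; have : v \in [seq tail e.1 | e <- acute_edges (p, k)].
    by move: v_y; rewrite /= !inE => /or3P[] ->; rewrite ?orbT.
  by case/mapP=> e e_y ->; apply: map_f; rewrite boundary_rhomb.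
move: fx; rewrite !inE => /or4P[/eqP|/eqP|/eqP f_x|/orP[/eqP f_x|/eqP f_x]];
  [exact: tri | exact: tri | | |].
- apply: (rh (next_corner x)); first by rewrite !inE eqxx orbT.
  by rewrite /acute face_next // f_x.
- by apply: (rh x); rewrite ?mem_head // /acute f_x.
- apply: (rh (next_corner (next_corner x))); first by rewrite !inE eqxx !orbT.
  by rewrite /acute !face_next // f_x.
Qed.

Lemma puzzle_of_puzzle : is_puzzle n puzzle_of.
Proof.
split; first split.
- by move=> q; rewrite mem_puzzle_of => /andP[].
- move=> [p up] c_in; have [q q_Q x_q] := @puzzle_of_piece (p, cell_dir up) c_in.
  exists q; split; first by split=> //; apply: (sector_sub x_q).
  move=> r [r_Q /(@sector_in_piece r (p, cell_dir up)) x_r].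
  move: q_Q r_Q; rewrite !mem_puzzle_of => /andP[_ q_m] /andP[_ r_m].
  exact: (matches_unique labN x_q x_r q_m r_m).
move=> q r e a b; rewrite !mem_puzzle_of => /andP[_ /andP[/allP q_m _]].
move=> /andP[_ /andP[/allP r_m _]] /q_m /= /eqP e_a /r_m /= /eqP.
by rewrite labN e_a => -[].
Qed.

Lemma puzzle_of_edge_label e b : all (in_triangle n) (sector_vertices (right_face e)) ->
  edge_label puzzle_of e b <-> lab e = Some b.
Proof.
move=> e_in; split=> [[q]|lab_e].
  by rewrite mem_puzzle_of => /andP[_ /andP[/allP q_m _]] /q_m /eqP.
have [q q_Q x_q] := puzzle_of_piece e_in; exists q => //.
move: q_Q; rewrite mem_puzzle_of => /andP[_ q_m].
by rewrite -{1}(right_faceK e); apply: (matches_edge labN x_q q_m); rewrite right_faceK.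
Qed.

End ToPuzzle.

(** * Gentle loops and rigidity *)

Lemma loop_of_gentle_loop n P s : is_puzzle n P -> gentle_loop P s ->
  exists L g, loop n (puzzle_label P) L g.
Proof.
move=> puzP [[reg steps] s_gt1 closed].
case: s reg steps s_gt1 closed => // e0 s reg steps s_gt1 closed.
have s_reg t : (t < size s)%N -> region (puzzle_label P) (nth e0 (e0 :: s) t) /\
    flanked n (nth e0 (e0 :: s) t).
  move=> lt_t; apply: (region_edge_region puzP); apply: reg.
  by apply: mem_nth; rewrite /= ltnS ltnW.
have step t : (t < size s)%N ->
    gentle_step (nth e0 (e0 :: s) t) (nth e0 (e0 :: s) t.+1).
  by move=> lt_t; apply: (sortedP e0 steps).
exists (size s), (fun t => nth e0 (e0 :: s) (t %% size s)%N).
apply: loop_of_path => //.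
- by move=> t /s_reg[].
- by move=> t /s_reg[].
- by move=> t /ltnW; apply: step.
have s_gt0 : (0 < size s)%N by [].
have := step (size s).-1; rewrite ltn_predL s_gt0 prednK //= => /(_ isT).
have -> : nth e0 (e0 :: s) (size s) = e0.
  by rewrite -[size s]/((size (e0 :: s)).-1) nth_last -closed.
by [].
Qed.

Theorem theorem7 (n : nat) (P : {fset piece}) :
  is_puzzle n P -> (exists s : seq dedge, gentle_loop P s) -> ~ rigid n P.
Proof.
move=> puzP [s sP] rigidP; have [L [g gP]] := loop_of_gentle_loop puzP sP.
apply: (gentle_loop_breathes (puzzle_labelling puzP) gP) => lab labP outer p k p_in.
have e_in : all (in_triangle n) (sector_vertices (right_face (p, k))).
  by case: p_in => p_tri nbr; rewrite /sector_vertices /= p_tri !nbr.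
have Q_eq : puzzle_of n lab = P.
  apply: rigidP; first exact: puzzle_of_puzzle.
  move=> e b e_out; have e_tri := outer_edge_right e_out.
  rewrite (puzzle_edge_label puzP) // (puzzle_of_edge_label labP) //.
  by rewrite outer.
have same b : lab (p, k) = Some b <-> puzzle_label P (p, k) = Some b.
  by rewrite -(puzzle_edge_label puzP) // -(puzzle_of_edge_label labP) // Q_eq.
case lab_e: (lab (p, k)) => [b|]; first by apply/esym/same.
by case lab_e': (puzzle_label P (p, k)) => [b|//]; move/same: lab_e'; rewrite lab_e.
Qed.
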